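(* Let $\varphi\in\mathrm{Fml}_B(\mathcal L_D)$ be a bounded formula with free variables $\vec x$, let $\mathcal F$ be an approximation of $\varphi$, let $0<\delta<\frac12$ be a rational constant and let $I:\mathrm{Term}(\varphi)\to\mathbb{IQ}$ be an enclosure of $\varphi$. Consider the two proof rules with the common premise $$\vdash\bigwedge_{f(e)\in\mathrm{Term}_F(\varphi)}\forall^{I_e}s\,\big(|\mathcal F_{f(e)}(s)-f(s)|\le\delta\big)$$ and conclusions, respectively, $$(\delta^\forall)\quad\vdash\forall^{I_{\vec x}}\vec x\,\big(\mathcal A^\forall_{\mathcal F}(\varphi,\delta)\to\varphi\big),\qquad(\delta^\exists)\quad\vdash\forall^{I_{\vec x}}\vec x\,\big(\varphi\to\mathcal A^\exists_{\mathcal F}(\varphi,\delta)\big).$$ Both proof rules are sound. If $I$ is furthermore a provable enclosure, then both proof rules are derivable (in dL).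
   Context: DIFFERENTIAL DYNAMIC LOGIC (dL), continuous fragment. Terms are built from real variables, rational constants, $+$, $\cdot$ and function symbols. Formulas are built from comparisons $p\sim q$ ($\sim\in\{=,\neq,\ge,>,\le,<\}$) by the propositional connectives, quantifiers over $\mathbb R$, and modalities $[x'=f(x)\&Q]P$ and $\langle x'=f(x)\&Q\rangle P$, where $x$ is a vector of variables and $Q$ a formula of first-order real arithmetic (omitted $Q$ means true). Let $\Phi_\omega:[0,\tau_{\max})\to$ states be the right-maximal solution of $x'=f(x)$ from state $\omega$. Then $\omega\models[x'=f(x)\&Q]P$ iff $\Phi_\omega(\tau)\models P$ for all $\tau\in[0,\tau_{\max})$ such that $\Phi_\omega(\xi)\models Q$ for all $\xi\in[0,\tau]$; and $\omega\models\langle x'=f(x)\&Q\rangle P$ iff $\Phi_\omega(\tau)\models P$ for some such $\tau$. Valid means true in all states. A proof rule is sound if validity of its premises entails validity of its conclusion. A formula is provable in dL, and a rule derivable in dL, if it can be derived (for a rule: its conclusion from its premise) in the classical first-order sequent calculus (with cut) from the axioms and rules of dL, listed as follows ($\alpha$ an ODE; $y$ fresh in Cont, Dadj, BDG): ($\mathbb R$) every sequent valid in first-order real arithmetic; $\langle\alpha\rangle P\leftrightarrow\neg[\alpha]\neg P$; $\langle x'=f(x)\rangle p(x)\leftrightarrow\exists t{\ge}0\,p(y(t))$ where $y'(t)=f(y)$ (symbolic solution from initial value $x$); $\langle x'=f(x)\&Q(x)\rangle\exists y\,P(x,y)\leftrightarrow\exists y\langle x'=f(x)\&Q(x)\rangle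 P(x,y)$ if $y\notin x$; (K) $[\alpha](P\to R)\to([\alpha]P\to[\alpha]R)$; (V) $P\to[\alpha]P$ if no free variable of $P$ is bound by $\alpha$; (G) from $\vdash P$ infer $\Gamma\vdash[\alpha]P$; (dW) from $Q\vdash P$ infer $\Gamma\vdash[x'=f(x)\&Q]P$; (dC) from $\Gamma\vdash[x'=f(x)\&Q]C$ and $\Gamma\vdash[x'=f(x)\&Q\wedge C]P$ infer $\Gamma\vdash[x'=f(x)\&Q]P$; (DG) $[x'=f(x)\&Q(x)]P(x)\leftrightarrow\exists y[x'=f(x),y'=a(x)y+b(x)\&Q(x)]P(x)$; (DGi) $[x'=f(x)\&Q(x)]P(x)\to\forall y[x'=f(x),y'=g(x,y)\&Q(x)]P(x)$; (DX) $[x'=f(x)\&Q]P\leftrightarrow(Q\to P\wedge[x'=f(x)\&Q]P)$ if $x'\notin P,Q$; (Uniq) $\langle x'=f(x)\&Q_1\wedge Q_2\rangle P\leftrightarrow\langle x'=f(x)\&Q_1\rangle P\wedge\langle x'=f(x)\&Q_2\rangle P$; (Cont) $x=y\to(\langle x'=f(x)\&e>0\rangle x\neq y\leftrightarrow e>0)$ if $f(x)\ne0$; (Dadj) $\langle x'=f(x)\&Q(x)\rangle x=y\leftrightarrow\langle y'=-f(y)\&Q(y)\rangle y=x$; (RI) $[x'=f(x)]P\leftrightarrow\forall y[x'=f(x)\&P\vee x=y](x=y\to P\wedge\langle x'=f(x)\&P\vee x=y\rangle x\ne y)$; (BDG) $[x'=f(x),y'=g(x,y)\&Q(x)]\|y\|^2\le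 p(x)\to([x'=f(x)\&Q(x)]P(x)\leftrightarrow[x'=f(x),y'=g(x,y)\&Q(x)]P(x))$ with $Q(x)$ a formula of real arithmetic; (FI) $e_0=h(e_1)\leftrightarrow\phi_h(e_0,e_1)$ for each differentially-defined function symbol $h$ with defining formula $\phi_h$ as follows. DIFFERENTIALLY-DEFINED FUNCTIONS. Each is a unary symbol $h$ given by $f\in\mathbb Q[x]^{n+1}$, $x=(x_0,\dots,x_n)$, $X\in\mathbb Q^{n+1}$, $T_0\in\mathbb Q$, with defining formula $\phi_h(x_0,t)\equiv\exists x_1\cdots x_n(\langle x'=-f(x),t'=-1\rangle(x=X\wedge t=T_0)\vee\langle x'=f(x),t'=1\rangle(x=X\wedge t=T_0))$, such that global existence, $\exists x_0\,\phi_h(x_0,t)$, is provable in dL. It is interpreted as $h:\mathbb R\to\mathbb R$, the $x_0$-coordinate of the global solution of $x'=f(x)$, $x(T_0)=X$. LANGUAGE. $\mathbb R_D$ is the real-closed field $\mathbb R$ expanded by all these functions; $\mathcal L_D$ is its language (rational constants, $+,\cdot,\ge,>$, and these unary symbols). $\mathrm{FOL}_{\mathbb R}$ is the set of first-order formulas of real arithmetic (without these function symbols); functions definable in it may be used in formulas. Atomic formulas have the form $t\ge0$ or $t>0$. Bounded quantifiers are $\exists^{[a,b]}y\,\chi:=\exists y(a\le y\wedge y\le b\wedge\chi)$ and $\forall^{[a,b]}y\,\chi:=\forall y(a\le y\wedge y\le b\to\chi)$. A bounded formula is $Q_1^{[a_1,b_1]}y_1\cdots Q_n^{[a_n,b_n]}y_n\,\psi$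 with $Q_i\in\{\exists,\forall\}$, $\psi$ quantifier-free in conjunctive normal form, where the $[a_i,b_i]$ are closed intervals whose endpoints are terms (assumed, without loss of generality, to contain no function symbols) that may depend on variables appearing before $y_i$. $\mathrm{Fml}_B(\mathcal L_D)$ is the set of bounded formulas. ENCLOSURES. $\mathbb{IQ}$ is the set of intervals $[\underline a,\overline a]$ with $\underline a\le\overline a$ in $\mathbb Q$. $\mathrm{Term}(\varphi)$ is the set of terms appearing in $\varphi$, $\mathrm{Term}_F(\varphi)$ the set of those of the form $f(e)$ with $f$ a function symbol. For $\varepsilon\in\mathbb Q^+$, an $\varepsilon$-enclosure of $\varphi$ is a function $I:\mathrm{Term}(\varphi)\to\mathbb{IQ}$, $e\mapsto I_e$, satisfying: for a free variable $x$, no requirement on $I_x\in\mathbb{IQ}$; for a variable $y$ bound via $Q^{[a,b]}y$, $I_a\cup I_b\subseteq I_y$; $I_{t_1}+I_{t_2}\subseteq I_{t_1+t_2}$ and $I_{t_1}\cdot I_{t_2}\subseteq I_{t_1\cdot t_2}$ (usual interval arithmetic); $f(I_e)+[-\varepsilon,\varepsilon]\subseteq I_{f(e)}$, where $f(I_e)$ is the image of $I_e$ under the interpretation of $f$. It is provable if these conditions are provable in dL. An enclosure is a $1$-enclosure. $\forall^{I_{\vec x}}\vec x$ abbreviates $\forall^{I_{x_1}}x_1\cdots\forall^{I_{x_n}}x_n$. APPROXIMATIONS. An approximation $\mathcal F$ of $\varphi$ assigns to each $f(e)\in\mathrm{Term}_F(\varphi)$ an $\mathrm{FOL}_{\mathbb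 R}$ formula defining a function $\mathcal F_{f(e)}:\mathbb R\to\mathbb R$. PERTURBATIONS. $\mathcal A^\forall_{\mathcal F}(\varphi,\delta)$ is defined inductively: it is $\varphi$ if $\varphi$ is atomic without function symbols; for atomic $t(f(e),\vec x)\succeq0$ ($\succeq\in\{\ge,>\}$, $e$ without function symbols) it is $\forall^{[\mathcal F_{f(e)}(e)-\delta,\ \mathcal F_{f(e)}(e)+\delta]}w\ \mathcal A^\forall_{\mathcal F_{w\mapsto f(e)}}(t(w,\vec x)\succeq0,\delta)$, where $w$ is fresh and replaces $f(e)$, and $\mathcal F_{w\mapsto f(e)}(\theta(w,\vec x)):=\mathcal F(\theta(f(e),\vec x))$; it commutes with $\wedge,\vee$ and bounded quantifiers. $\mathcal A^\exists_{\mathcal F}(\varphi,\delta)$ is defined identically with $\exists w$ in place of $\forall w$.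
   Formalization: Enclosures are also required to satisfy c ∈ I_c for each rational constant c (otherwise false, e.g. f(2)≥0 with I_2=[0,0], f(s)=−s, F(s)=s), and axiom RI is given the antecedent f(x)≠0, since as listed it fails at equilibria. *)

(* Defs.v *)
From Stdlib Require Import Reals QArith Qreals List Arith Lia Permutation.
From Stdlib Require Import Classical ClassicalEpsilon.
From Coquelicot Require Import Rbar.
Import ListNotations.
Open Scope R_scope.

Definition var := nat.

(** Rational polynomials in the variables x_0, x_1, ... (by index). *)
Inductive poly : Type :=
| pVar (i : nat)
| pConst (c : Q)
| pAdd (p q : poly)
| pMul (p q : poly).

(** The data (f, X, T_0) defining a function symbol; n + 1 is the length of the
    two lists.  Symbols are bare data: whether a symbol really is
    differentially-defined (i.e. its global existence is provable) is the
    predicate [diff_defined] below, once provability is available. *)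
Record fsym : Type := FSym {
  fs_field : list poly;
  fs_init : list Q;
  fs_time : Q
}.

Inductive term : Type :=
| tVar (x : var)
| tConst (c : Q)
| tAdd (s t : term)
| tMul (s t : term)
| tApp (h : fsym) (e : term).

Definition tNeg (e : term) : term := tMul (tConst (-1)) e.
Definition tSub (s t : term) : term := tAdd s (tNeg t).

Inductive cmp : Type := Ceq | Cne | Cge | Cgt | Cle | Clt.

Definition ode := list (var * term).

Definition dom (al : ode) : list var := map fst al.

Inductive fml : Type :=
| fCmp (c : cmp) (p q : term)
| fNot (P : fml)
| fAnd (P R : fml)
| fOr (P R : fml)
| fImp (P R : fml)
| fAll (x : var) (P : fml)
| fEx (x : var) (P : fml)
| fBox (al : ode) (Q P : fml)
| fDia (al : ode) (Q P : fml).

Definition fIff (P R : fml) : fml := fAnd (fImp P R) (fImp R P).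
Definition fLe (s t : term) : fml := fCmp Cle s t.
Definition fEq (s t : term) : fml := fCmp Ceq s t.
Definition fTrue : fml := fEq (tConst 0) (tConst 0).
Definition fFalse : fml := fCmp Cne (tConst 0) (tConst 0).

Definition big_and (l : list fml) : fml := fold_right fAnd fTrue l.
Definition big_or (l : list fml) : fml := fold_right fOr fFalse l.

Definition vec_eq (es es' : list term) : fml :=
  big_and (map (fun p => fEq (fst p) (snd p)) (combine es es')).
Definition vec_ne (es es' : list term) : fml := fNot (vec_eq es es').

Definition foralls (xs : list var) (P : fml) : fml := fold_right fAll P xs.
Definition existss (xs : list var) (P : fml) : fml := fold_right fEx P xs.

Lemma Q_eq_dec : forall a b : Q, {a = b} + {a <> b}.
Proof. decide equality; [apply Pos.eq_dec | apply Z.eq_dec]. Defined.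

Lemma poly_eq_dec : forall p q : poly, {p = q} + {p <> q}.
Proof. decide equality; [apply Nat.eq_dec | apply Q_eq_dec]. Defined.

Lemma fsym_eq_dec : forall h k : fsym, {h = k} + {h <> k}.
Proof.
  decide equality.
  - apply Q_eq_dec.
  - apply (list_eq_dec Q_eq_dec).
  - apply (list_eq_dec poly_eq_dec).
Defined.

Lemma term_eq_dec : forall s t : term, {s = t} + {s <> t}.
Proof.
  decide equality; [apply Nat.eq_dec | apply Q_eq_dec | apply fsym_eq_dec].
Qed.

Fixpoint tvars (t : term) : list var :=
  match t with
  | tVar x => [x]
  | tConst _ => []
  | tAdd s t | tMul s t => tvars s ++ tvars t
  | tApp _ e => tvars e
  end.

Definition ode_vars (al : ode) : list var :=
  dom al ++ flat_map (fun p => tvars (snd p)) al.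

(** The variables evolved by a modality are free in it: it reads their initial
    values. *)
Fixpoint fv (P : fml) : list var :=
  match P with
  | fCmp _ p q => tvars p ++ tvars q
  | fNot P => fv P
  | fAnd P R | fOr P R | fImp P R => fv P ++ fv R
  | fAll x P | fEx x P => remove Nat.eq_dec x (fv P)
  | fBox al Q P | fDia al Q P => ode_vars al ++ fv Q ++ fv P
  end.

Definition disjoint (l l' : list var) : Prop := forall x, In x l -> ~ In x l'.

Definition fresh (l : list var) : var := S (list_max l).

Definition upd {A : Type} (w : var -> A) (x : var) (a : A) : var -> A :=
  fun y => if Nat.eq_dec y x then a else w y.

Fixpoint vsub (xs : list var) (es : list term) : var -> term :=
  match xs, es with
  | x :: xs, e :: es => upd (vsub xs es) x e
  | _, _ => tVar
  end.

Fixpoint tsubst (s : var -> term) (t : term) : term :=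
  match t with
  | tVar x => s x
  | tConst c => tConst c
  | tAdd t u => tAdd (tsubst s t) (tsubst s u)
  | tMul t u => tMul (tsubst s t) (tsubst s u)
  | tApp h e => tApp h (tsubst s e)
  end.

Definition ode_subst (s : var -> term) (al : ode) : ode :=
  map (fun p => (fst p, tsubst s (snd p))) al.

(** The name that binder [x] of body [P] gets when [s] is applied below it: [x]
    itself unless it would capture. *)
Definition binder (s : var -> term) (x : var) (P : fml) : var :=
  let l := flat_map (fun z => tvars (s z)) (remove Nat.eq_dec x (fv P)) in
  if in_dec Nat.eq_dec x l then fresh l else x.

Fixpoint subst (s : var -> term) (P : fml) : fml :=
  match P with
  | fCmp c p q => fCmp c (tsubst s p) (tsubst s q)
  | fNot P => fNot (subst s P)
  | fAnd P R => fAnd (subst s P) (subst s R)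
  | fOr P R => fOr (subst s P) (subst s R)
  | fImp P R => fImp (subst s P) (subst s R)
  | fAll x P =>
      let z := binder s x P in fAll z (subst (upd s x (tVar z)) P)
  | fEx x P =>
      let z := binder s x P in fEx z (subst (upd s x (tVar z)) P)
  | fBox al Q P => fBox (ode_subst s al) (subst s Q) (subst s P)
  | fDia al Q P => fDia (ode_subst s al) (subst s Q) (subst s P)
  end.

(** Quantifiers are renamed by [subst], but variables bound by an ODE are not;
    [adm] excludes substituting for, or capturing at, the latter. *)
Fixpoint adm (s : var -> term) (P : fml) : Prop :=
  match P with
  | fCmp _ _ _ => True
  | fNot P => adm s P
  | fAnd P R | fOr P R | fImp P R => adm s P /\ adm s R
  | fAll x P | fEx x P => adm (upd s x (tVar (binder s x P))) P
  | fBox al Q P | fDia al Q P =>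
      (forall x, In x (dom al) -> s x = tVar x) /\
      (forall z, In z (fv (fBox al Q P)) -> ~ In z (dom al) ->
                 disjoint (tvars (s z)) (dom al)) /\
      adm s Q /\ adm s P
  end.

Definition sub1 (x : var) (e : term) : var -> term := upd tVar x e.

Definition swap (x z v : var) : var :=
  if Nat.eq_dec v x then z else if Nat.eq_dec v z then x else v.

(** Renaming of all occurrences, bound ones included. *)
Fixpoint rename (r : var -> var) (P : fml) : fml :=
  let rt := tsubst (fun x => tVar (r x)) in
  let ro := map (fun p => (r (fst p), rt (snd p))) in
  match P with
  | fCmp c p q => fCmp c (rt p) (rt q)
  | fNot P => fNot (rename r P)
  | fAnd P R => fAnd (rename r P) (rename r R)
  | fOr P R => fOr (rename r P) (rename r R)
  | fImp P R => fImp (rename r P) (rename r R)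
  | fAll x P => fAll (r x) (rename r P)
  | fEx x P => fEx (r x) (rename r P)
  | fBox al Q P => fBox (ro al) (rename r Q) (rename r P)
  | fDia al Q P => fDia (ro al) (rename r Q) (rename r P)
  end.

Fixpoint no_fsym (t : term) : Prop :=
  match t with
  | tVar _ | tConst _ => True
  | tAdd s t | tMul s t => no_fsym s /\ no_fsym t
  | tApp _ _ => False
  end.

Fixpoint fol_R (P : fml) : Prop :=
  match P with
  | fCmp _ p q => no_fsym p /\ no_fsym q
  | fNot P => fol_R P
  | fAnd P R | fOr P R | fImp P R => fol_R P /\ fol_R R
  | fAll _ P | fEx _ P => fol_R P
  | fBox _ _ _ | fDia _ _ _ => False
  end.

Fixpoint wf (P : fml) : Prop :=
  match P with
  | fCmp _ _ _ => True
  | fNot P => wf P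
  | fAnd P R | fOr P R | fImp P R => wf P /\ wf R
  | fAll _ P | fEx _ P => wf P
  | fBox al Q P | fDia al Q P => NoDup (dom al) /\ fol_R Q /\ wf P
  end.

Definition state := var -> R.

Fixpoint peval (w : nat -> R) (p : poly) : R :=
  match p with
  | pVar i => w i
  | pConst c => Q2R c
  | pAdd p q => peval w p + peval w q
  | pMul p q => peval w p * peval w q
  end.

Definition global_solution (h : fsym) (y : R -> nat -> R) : Prop :=
  forall i, (i < length (fs_field h))%nat ->
    y (Q2R (fs_time h)) i = Q2R (nth i (fs_init h) 0%Q) /\
    forall t, derivable_pt_lim (fun s => y s i) t
                (peval (y t) (nth i (fs_field h) (pConst 0))).

(** The x_0-coordinate of the global solution (unique by Picard-Lindeloef).  Data
    without a global solution, hence never a differentially-defined function, get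
    the constant 0. *)
Definition interp (h : fsym) : R -> R :=
  match excluded_middle_informative (exists y, global_solution h y) with
  | left E => fun t => proj1_sig (constructive_indefinite_description _ E) t 0%nat
  | right _ => fun _ => 0
  end.

Fixpoint eval (w : state) (t : term) : R :=
  match t with
  | tVar x => w x
  | tConst c => Q2R c
  | tAdd s t => eval w s + eval w t
  | tMul s t => eval w s * eval w t
  | tApp h e => interp h (eval w e)
  end.

Definition before (T : Rbar) (t : R) : Prop := 0 <= t /\ Rbar_lt t T.

(** [Phi] solves the system from [w] on [0, T); derivatives are one-sided at 0. *)
Definition solution (al : ode) (w : state) (T : Rbar) (Phi : R -> state) : Prop :=
  Rbar_lt 0 T /\
  (forall x, Phi 0 x = w x) /\
  (forall t x, before T t -> ~ In x (dom al) -> Phi t x = w x) /\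
  (forall t x e, before T t -> In (x, e) al ->
     D_in (fun s => Phi s x) (fun s => eval (Phi s) e) (before T) t).

Definition right_maximal (al : ode) (w : state) (T : Rbar) (Phi : R -> state) : Prop :=
  solution al w T Phi /\
  forall T' Psi, solution al w T' Psi ->
    (forall t x, before T t -> before T' t -> Psi t x = Phi t x) -> Rbar_le T' T.

Definition cmp_sem (c : cmp) (a b : R) : Prop :=
  match c with
  | Ceq => a = b
  | Cne => a <> b
  | Cge => a >= b
  | Cgt => a > b
  | Cle => a <= b
  | Clt => a < b
  end.

Fixpoint sat (w : state) (P : fml) : Prop :=
  match P with
  | fCmp c p q => cmp_sem c (eval w p) (eval w q)
  | fNot P => ~ sat w P
  | fAnd P R => sat w P /\ sat w R
  | fOr P R => sat w P \/ sat w R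
  | fImp P R => sat w P -> sat w R
  | fAll x P => forall a, sat (upd w x a) P
  | fEx x P => exists a, sat (upd w x a) P
  | fBox al Q P =>
      forall T Phi, right_maximal al w T Phi ->
      forall t, before T t ->
        (forall u, 0 <= u <= t -> sat (Phi u) Q) -> sat (Phi t) P
  | fDia al Q P =>
      exists T Phi, right_maximal al w T Phi /\
      exists t, before T t /\
        (forall u, 0 <= u <= t -> sat (Phi u) Q) /\ sat (Phi t) P
  end.

Definition valid (P : fml) : Prop := forall w, sat w P.

Definition valid_seq (G D : list fml) : Prop :=
  forall w, (forall P, In P G -> sat w P) -> exists P, In P D /\ sat w P.

Fixpoint pvars (p : poly) : list nat :=
  match p with
  | pVar i => [i]
  | pConst _ => []
  | pAdd p q | pMul p q => pvars p ++ pvars q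
  end.

Fixpoint pterm (xs : list var) (p : poly) : term :=
  match p with
  | pVar i => tVar (nth i xs 0%nat)
  | pConst c => tConst c
  | pAdd p q => tAdd (pterm xs p) (pterm xs q)
  | pMul p q => tMul (pterm xs p) (pterm xs q)
  end.

Definition fsym_wf (h : fsym) : Prop :=
  fs_field h <> [] /\ length (fs_init h) = length (fs_field h) /\
  forall p i, In p (fs_field h) -> In i (pvars p) -> (i < length (fs_field h))%nat.

(** phi_h(x_0, t), where [xs] names the variables x_0, ..., x_n. *)
Definition phi (h : fsym) (xs : list var) (t : var) : fml :=
  let f := map (pterm xs) (fs_field h) in
  let goal := fAnd (vec_eq (map tVar xs) (map tConst (fs_init h)))
                  (fEq (tVar t) (tConst (fs_time h))) in
  existss (tl xs)
    (fOr (fDia (combine xs (map tNeg f) ++ [(t, tConst (-1))]) fTrue goal)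
        (fDia (combine xs f ++ [(t, tConst 1)]) fTrue goal)).

(** phi_h(e_0, e_1): the variables x_0 and t are evolved in phi_h, so that terms
    are passed as their initial values. *)
Definition phi_at (h : fsym) (xs : list var) (t : var) (e0 e1 : term) : fml :=
  let x0 := hd 0%nat xs in
  fEx x0 (fEx t
    (fAnd (fAnd (fEq (tVar x0) e0) (fEq (tVar t) e1)) (phi h xs t))).

Definition global_existence (h : fsym) : fml :=
  let n1 := length (fs_field h) in
  fEx 0%nat (phi h (seq 0 n1) n1).

(** [es], terms over the variables of [al] and the time variable [t], is a
    solution of [al] starting from the values of [dom al]. *)
Definition symbolic_solution (al : ode) (t : var) (es : list term) : Prop :=
  length es = length al /\
  forall w : state,
    let y := fun (s : R) (x : var) => eval (upd w t s) (vsub (dom al) es x) in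
    (forall x, In x (dom al) -> y 0 x = w x) /\
    (forall s x e, 0 <= s -> In (x, e) al ->
       derivable_pt_lim (fun s => y s x) s (eval (y s) e)).

Definition ode_ne0 (al : ode) : fml :=
  vec_ne (map snd al) (map (fun _ => tConst 0) al).

Definition norm2 (ys : list var) : term :=
  fold_right (fun y t => tAdd (tMul (tVar y) (tVar y)) t) (tConst 0) ys.

(** Freshness of [ys] as in x' = f(x) & Q(x), P(x). *)
Definition fresh_in (ys : list var) (al : ode) (Q P : fml) : Prop :=
  disjoint ys (fv (fBox al Q P)).

Inductive dL_axiom : fml -> Prop :=
| ax_eq x a b P :
    adm (sub1 x a) P -> adm (sub1 x b) P ->
    dL_axiom (fImp (fEq a b) (fImp (subst (sub1 x a) P) (subst (sub1 x b) P)))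
| ax_rename_all x z P : ~ In z (fv P) ->
    dL_axiom (fIff (fAll x P) (fAll z (rename (swap x z) P)))
| ax_rename_ex x z P : ~ In z (fv P) ->
    dL_axiom (fIff (fEx x P) (fEx z (rename (swap x z) P)))
(* an ODE is an unordered system of equations *)
| ax_perm al al' Q P : Permutation al al' ->
    dL_axiom (fIff (fBox al Q P) (fBox al' Q P))
| ax_dual al Q P :
    dL_axiom (fIff (fDia al Q P) (fNot (fBox al Q (fNot P))))
| ax_solve al t es p :
    fresh_in [t] al fTrue p -> symbolic_solution al t es ->
    adm (vsub (dom al) es) p ->
    dL_axiom (fIff (fDia al fTrue p)
                  (fEx t (fAnd (fCmp Cge (tVar t) (tConst 0))
                                  (subst (vsub (dom al) es) p))))
| ax_barcan al Q y P : fresh_in [y] al Q fTrue ->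
    dL_axiom (fIff (fDia al Q (fEx y P)) (fEx y (fDia al Q P)))
| ax_K al Q P R :
    dL_axiom (fImp (fBox al Q (fImp P R)) (fImp (fBox al Q P) (fBox al Q R)))
| ax_V al Q P : disjoint (fv P) (dom al) ->
    dL_axiom (fImp P (fBox al Q P))
| ax_DG al Q P y a b :
    fresh_in [y] al Q P -> ~ In y (tvars a) -> ~ In y (tvars b) ->
    dL_axiom (fIff (fBox al Q P)
                  (fEx y (fBox (al ++ [(y, tAdd (tMul a (tVar y)) b)]) Q P)))
| ax_DGi al Q P be : fresh_in (dom be) al Q P ->
    dL_axiom (fImp (fBox al Q P) (foralls (dom be) (fBox (al ++ be) Q P)))
| ax_DX al Q P :
    dL_axiom (fIff (fBox al Q P) (fImp Q (fAnd P (fBox al Q P))))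
| ax_Uniq al Q1 Q2 P :
    dL_axiom (fIff (fDia al (fAnd Q1 Q2) P) (fAnd (fDia al Q1 P) (fDia al Q2 P)))
| ax_Cont al e ys :
    let Q := fCmp Cgt e (tConst 0) in
    length ys = length al -> NoDup ys -> fresh_in ys al Q fTrue ->
    dL_axiom (fImp (ode_ne0 al)
               (fImp (vec_eq (map tVar (dom al)) (map tVar ys))
                    (fIff (fDia al Q (vec_ne (map tVar (dom al)) (map tVar ys))) Q)))
| ax_Dadj al Q ys :
    let xs := dom al in
    let s := vsub xs (map tVar ys) in
    length ys = length al -> NoDup ys -> fresh_in ys al Q fTrue -> adm s Q ->
    dL_axiom (fIff (fDia al Q (vec_eq (map tVar xs) (map tVar ys)))
                  (fDia (combine ys (map (fun p => tNeg (tsubst s (snd p))) al))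
                       (subst s Q) (vec_eq (map tVar ys) (map tVar xs))))
(* f(x) <> 0 is needed: at an equilibrium the left-hand side may hold although no
   state other than y is ever reached *)
| ax_RI al P ys :
    let eqy := vec_eq (map tVar (dom al)) (map tVar ys) in
    length ys = length al -> NoDup ys -> fresh_in ys al fTrue P ->
    dL_axiom (fImp (ode_ne0 al)
               (fIff (fBox al fTrue P)
                    (foralls ys
                       (fBox al (fOr P eqy)
                          (fImp eqy (fAnd P (fDia al (fOr P eqy) (fNot eqy))))))))
| ax_BDG al be Q P p :
    fol_R Q -> fresh_in (dom be) al Q P -> disjoint (dom be) (tvars p) ->
    dL_axiom (fImp (fBox (al ++ be) Q (fLe (norm2 (dom be)) p))
                  (fIff (fBox al Q P) (fBox (al ++ be) Q P))).

(** [prov H G D]: the sequent G |- D is derivable from the premises [H].  In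
    [pr_FI] the symbol must be differentially-defined, i.e. its global existence
    must be provable without premises. *)
Inductive prov : list (list fml * list fml) -> list fml -> list fml -> Prop :=
| pr_hyp H G D : In (G, D) H -> prov H G D
| pr_id H P : prov H [P] [P]
| pr_struct H G D G' D' : prov H G D -> incl G G' -> incl D D' -> prov H G' D'
| pr_cut H G D P : prov H G (P :: D) -> prov H (P :: G) D -> prov H G D
| pr_notL H G D P : prov H G (P :: D) -> prov H (fNot P :: G) D
| pr_notR H G D P : prov H (P :: G) D -> prov H G (fNot P :: D)
| pr_andL H G D P R : prov H (P :: R :: G) D -> prov H (fAnd P R :: G) D
| pr_andR H G D P R :
    prov H G (P :: D) -> prov H G (R :: D) -> prov H G (fAnd P R :: D)
| pr_orL H G D P R :
    prov H (P :: G) D -> prov H (R :: G) D -> prov H (fOr P R :: G) D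
| pr_orR H G D P R : prov H G (P :: R :: D) -> prov H G (fOr P R :: D)
| pr_impL H G D P R :
    prov H G (P :: D) -> prov H (R :: G) D -> prov H (fImp P R :: G) D
| pr_impR H G D P R : prov H (P :: G) (R :: D) -> prov H G (fImp P R :: D)
| pr_allL H G D x P e :
    adm (sub1 x e) P ->
    prov H (subst (sub1 x e) P :: G) D -> prov H (fAll x P :: G) D
| pr_allR H G D x P :
    ~ In x (flat_map fv (G ++ D)) ->
    prov H G (P :: D) -> prov H G (fAll x P :: D)
| pr_exL H G D x P :
    ~ In x (flat_map fv (G ++ D)) ->
    prov H (P :: G) D -> prov H (fEx x P :: G) D
| pr_exR H G D x P e :
    adm (sub1 x e) P ->
    prov H G (subst (sub1 x e) P :: D) -> prov H G (fEx x P :: D)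
| pr_real H G D :
    (forall P, In P (G ++ D) -> fol_R P) -> valid_seq G D -> prov H G D
| pr_axiom H P : dL_axiom P -> wf P -> prov H [] [P]
| pr_G H G al Q P :
    wf (fBox al Q P) -> prov H [] [P] -> prov H G [fBox al Q P]
| pr_dW H G al Q P :
    wf (fBox al Q P) -> prov H [Q] [P] -> prov H G [fBox al Q P]
| pr_dC H G D al Q C P :
    wf (fBox al (fAnd Q C) P) ->
    prov H G (fBox al Q C :: D) -> prov H G (fBox al (fAnd Q C) P :: D) ->
    prov H G (fBox al Q P :: D)
| pr_FI H h xs t e0 e1 :
    fsym_wf h -> prov [] [] [global_existence h] ->
    length xs = length (fs_field h) -> NoDup (t :: xs) ->
    disjoint (t :: xs) (tvars e0 ++ tvars e1) ->
    prov H [] [fIff (fEq e0 (tApp h e1)) (phi_at h xs t e0 e1)].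

Definition provable (P : fml) : Prop := prov [] [] [P].

Definition sound_rule (P C : fml) : Prop := valid P -> valid C.
Definition derivable_rule (P C : fml) : Prop := prov [([], [P])] [] [C].

Definition diff_defined (h : fsym) : Prop :=
  fsym_wf h /\ provable (global_existence h).

Inductive quant : Type := QAll | QEx.

Definition bquant (q : quant) (y : var) (a b : term) (P : fml) : fml :=
  match q with
  | QAll => fAll y (fImp (fAnd (fLe a (tVar y)) (fLe (tVar y) b)) P)
  | QEx => fEx y (fAnd (fAnd (fLe a (tVar y)) (fLe (tVar y) b)) P)
  end.

Inductive rel : Type := Ge0 | Gt0.

Definition atom : Type := (rel * term)%type.

Definition atom_fml (a : atom) : fml :=
  match a with
  | (Ge0, t) => fCmp Cge t (tConst 0)
  | (Gt0, t) => fCmp Cgt t (tConst 0)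
  end.

Inductive bfml : Type :=
| BMatrix (psi : list (list atom))
| BQuant (q : quant) (y : var) (a b : term) (chi : bfml).

Fixpoint bfml_fml (ph : bfml) : fml :=
  match ph with
  | BMatrix psi => big_and (map (fun c => big_or (map atom_fml c)) psi)
  | BQuant q y a b chi => bquant q y a b (bfml_fml chi)
  end.

Fixpoint subterms (t : term) : list term :=
  t :: match t with
       | tVar _ | tConst _ => []
       | tAdd s u | tMul s u => subterms s ++ subterms u
       | tApp _ e => subterms e
       end.

(** Term(phi) *)
Fixpoint bterms (ph : bfml) : list term :=
  match ph with
  | BMatrix psi => flat_map (fun a => subterms (snd a)) (concat psi)
  | BQuant _ y a b chi => tVar y :: subterms a ++ subterms b ++ bterms chi
  end.

(** Term_F(phi) *)
Definition bapps (ph : bfml) : list (fsym * term) :=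
  flat_map (fun t => match t with tApp h e => [(h, e)] | _ => [] end) (bterms ph).

Fixpoint bounds (ph : bfml) : list (var * term * term) :=
  match ph with
  | BMatrix _ => []
  | BQuant _ y a b chi => (y, a, b) :: bounds chi
  end.

Definition Fml_B (ph : bfml) : Prop :=
  (forall y a b, In (y, a, b) (bounds ph) ->
     no_fsym a /\ no_fsym b /\ ~ In y (tvars a ++ tvars b)) /\
  (forall h e, In (h, e) (bapps ph) -> diff_defined h).

Record QIntv : Type := mkQIntv { lo : Q; hi : Q; lo_le_hi : (lo <= hi)%Q }.

Definition rin (u : R) (J : QIntv) : Prop := Q2R (lo J) <= u <= Q2R (hi J).

(** The requirement on constants is the usual interval arithmetic, in which c is
    the interval [c, c]. *)
Definition enclosure (eps : Q) (I : term -> QIntv) (ph : bfml) : Prop :=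
  (forall c, In (tConst c) (bterms ph) -> rin (Q2R c) (I (tConst c))) /\
  (forall y a b u, In (y, a, b) (bounds ph) ->
     rin u (I a) \/ rin u (I b) -> rin u (I (tVar y))) /\
  (forall t1 t2 u v, In (tAdd t1 t2) (bterms ph) ->
     rin u (I t1) -> rin v (I t2) -> rin (u + v) (I (tAdd t1 t2))) /\
  (forall t1 t2 u v, In (tMul t1 t2) (bterms ph) ->
     rin u (I t1) -> rin v (I t2) -> rin (u * v) (I (tMul t1 t2))) /\
  (forall h e u r, In (tApp h e) (bterms ph) ->
     rin u (I e) -> - Q2R eps <= r <= Q2R eps ->
     rin (interp h u + r) (I (tApp h e))).

Definition fin (e : term) (J : QIntv) : fml :=
  fAnd (fLe (tConst (lo J)) e) (fLe e (tConst (hi J))).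

Definition forall_in (x : var) (J : QIntv) (P : fml) : fml :=
  bquant QAll x (tConst (lo J)) (tConst (hi J)) P.

(** The conditions of [enclosure], each stated in dL and provable. *)
Definition provable_enclosure (eps : Q) (I : term -> QIntv) (ph : bfml) : Prop :=
  let x := 0%nat in let y := 1%nat in
  (forall c, In (tConst c) (bterms ph) -> provable (fin (tConst c) (I (tConst c)))) /\
  (forall z a b, In (z, a, b) (bounds ph) ->
     provable (fAll x (fImp (fOr (fin (tVar x) (I a)) (fin (tVar x) (I b)))
                              (fin (tVar x) (I (tVar z)))))) /\
  (forall t1 t2, In (tAdd t1 t2) (bterms ph) ->
     provable (forall_in x (I t1) (forall_in y (I t2)
       (fin (tAdd (tVar x) (tVar y)) (I (tAdd t1 t2)))))) /\
  (forall t1 t2, In (tMul t1 t2) (bterms ph) ->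
     provable (forall_in x (I t1) (forall_in y (I t2)
       (fin (tMul (tVar x) (tVar y)) (I (tMul t1 t2)))))) /\
  (forall h e, In (tApp h e) (bterms ph) ->
     provable (forall_in x (I e)
       (bquant QAll y (tConst (- eps)) (tConst eps)
         (fin (tAdd (tApp h (tVar x)) (tVar y)) (I (tApp h e)))))).

(** A formula defining a function R -> R: input variable 0, output variable 1. *)
Definition defines_function (G : fml) : Prop :=
  fol_R G /\ incl (fv G) [0%nat; 1%nat] /\
  forall w a, exists! b, sat (upd (upd w 0%nat a) 1%nat b) G.

(** G(e) = z *)
Definition graph (G : fml) (e z : term) : fml := subst (vsub [0%nat; 1%nat] [e; z]) G.

(** The formula [K] with the definable function value G(e) for its argument;
    [l] lists the variables of [K]. *)
Definition with_value (G : fml) (e : term) (l : list var) (K : term -> fml) : fml :=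
  let z := fresh (tvars e ++ l) in
  fEx z (fAnd (graph G e (tVar z)) (K (tVar z))).

Definition approx : Type := term -> fml.

Definition approximation (F : approx) (ph : bfml) : Prop :=
  forall h e, In (h, e) (bapps ph) -> defines_function (F (tApp h e)).

(** Bounded quantifier over [G(e) - delta, G(e) + delta]. *)
Definition quant_near (q : quant) (w : var) (G : fml) (e : term) (delta : Q)
    (P : fml) : fml :=
  let range := with_value G e [w] (fun v =>
    fAnd (fLe (tSub v (tConst delta)) (tVar w)) (fLe (tVar w) (tAdd v (tConst delta)))) in
  match q with
  | QAll => fAll w (fImp range P)
  | QEx => fEx w (fAnd range P)
  end.

Fixpoint replace (h : fsym) (e : term) (w : var) (t : term) : term :=
  match t with
  | tVar _ | tConst _ => t
  | tAdd s u => tAdd (replace h e w s) (replace h e w u)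
  | tMul s u => tMul (replace h e w s) (replace h e w u)
  | tApp k s =>
      if term_eq_dec (tApp k s) (tApp h e) then tVar w
      else tApp k (replace h e w s)
  end.

(** The perturbation is determined up to the order in which function applications
    are eliminated and up to the choice of fresh variables, hence a relation. *)
Inductive perturb_atom (q : quant) (delta : Q) : approx -> atom -> fml -> Prop :=
| pa_base F r t : no_fsym t -> perturb_atom q delta F (r, t) (atom_fml (r, t))
| pa_step F r t h e w P :
    In (tApp h e) (subterms t) -> no_fsym e -> ~ In w (tvars t) ->
    perturb_atom q delta (fun th => F (tsubst (sub1 w (tApp h e)) th))
      (r, replace h e w t) P ->
    perturb_atom q delta F (r, t) (quant_near q w (F (tApp h e)) e delta P).

Inductive perturb (q : quant) (delta : Q) (F : approx) : bfml -> fml -> Prop :=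
| pb_matrix psi psi' :
    Forall2 (Forall2 (perturb_atom q delta F)) psi psi' ->
    perturb q delta F (BMatrix psi) (big_and (map big_or psi'))
| pb_quant k y a b chi P :
    perturb q delta F chi P ->
    perturb q delta F (BQuant k y a b chi) (bquant k y a b P).

Fixpoint fsym_count (t : term) : nat :=
  match t with
  | tVar _ | tConst _ => 0
  | tAdd s u | tMul s u => fsym_count s + fsym_count u
  | tApp _ e => S (fsym_count e)
  end.

Lemma innermost t : no_fsym t \/ exists h e, In (tApp h e) (subterms t) /\ no_fsym e.
Proof.
  induction t as [x|c|s IHs u IHu|s IHs u IHu|k s IHs]; simpl; auto.
  1,2: destruct IHs as [Hs|(h & e & Hin & He)];
    [ destruct IHu as [Hu|(h & e & Hin & He)]; [left; auto|]
    | ]; right; exists h, e; rewrite in_app_iff; auto.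
  destruct IHs as [Hs|(h & e & Hin & He)]; right; [exists k, s|exists h, e]; auto.
Qed.

Lemma count_replace_le h e w t : (fsym_count (replace h e w t) <= fsym_count t)%nat.
Proof.
  induction t; simpl; repeat (match goal with |- context [term_eq_dec ?a ?b] => destruct (term_eq_dec a b) end); simpl; lia.
Qed.

Lemma count_replace_lt h e w t : In (tApp h e) (subterms t) ->
  (fsym_count (replace h e w t) < fsym_count t)%nat.
Proof.
  induction t as [x|c|s IHs u IHu|s IHs u IHu|k s IHs]; simpl;
    (intros [H|H]; [try discriminate|]); try contradiction;
    repeat (match goal with |- context [term_eq_dec ?a ?b] => destruct (term_eq_dec a b) as [E|E] end); try discriminate; simpl; try lia.
  1,2: apply in_app_iff in H; pose proof (count_replace_le h e w s);
    pose proof (count_replace_le h e w u); destruct H as [H|H];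
    [specialize (IHs H)|specialize (IHu H)]; lia.
  - congruence.
  - specialize (IHs H); lia.
Qed.

Lemma perturb_atom_total q delta F a : exists P, perturb_atom q delta F a P.
Proof.
  destruct a as [r t]. remember (fsym_count t) as n eqn:Hn.
  revert t F Hn. induction n as [n IH] using lt_wf_ind. intros t F Hn.
  destruct (innermost t) as [Ht|(h & e & Hin & He)].
  - eexists. now apply pa_base.
  - destruct (IH (fsym_count (replace h e (fresh (tvars t)) t))
      ltac:(subst n; now apply count_replace_lt) _
      (fun th => F (tsubst (sub1 (fresh (tvars t)) (tApp h e)) th)) eq_refl) as [P HP].
    eexists. eapply pa_step; eauto.
    intro Hw. assert (HM := proj1 (list_max_le (tvars t) _) (le_n _)).
    rewrite Forall_forall in HM. specialize (HM _ Hw). unfold fresh in HM. lia.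
Qed.

Lemma Forall2_total {A B : Type} (Rel : A -> B -> Prop) (l : list A) :
  (forall a, exists b, Rel a b) -> exists l', Forall2 Rel l l'.
Proof.
  intros Htot. induction l as [|a l [l' IH]]; [now exists []|].
  destruct (Htot a) as [b Hb]. exists (b :: l'). now constructor.
Qed.

Lemma perturb_total q delta F ph : exists P, perturb q delta F ph P.
Proof.
  induction ph as [psi|k y a b chi [P IH]].
  - destruct (Forall2_total (Forall2 (perturb_atom q delta F)) psi) as [psi' H].
    { intro. apply Forall2_total. intro. apply perturb_atom_total. }
    eexists. apply pb_matrix. eassumption.
  - eexists. apply pb_quant. exact IH.
Qed.

Definition delta_premise (F : approx) (delta : Q) (I : term -> QIntv) (ph : bfml) : fml :=
  let s := 0%nat in
  big_and (map (fun he : fsym * term =>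
    let (h, e) := he in
    forall_in s (I e)
      (with_value (F (tApp h e)) (tVar s) [s] (fun v =>
         fAnd (fLe (tConst (- delta)) (tSub v (tApp h (tVar s))))
             (fLe (tSub v (tApp h (tVar s))) (tConst delta)))))
    (bapps ph)).

Definition foralls_in (I : term -> QIntv) (xs : list var) (P : fml) : fml :=
  fold_right (fun x => forall_in x (I (tVar x))) P xs.

(* Main.v *)
(** The perturbation of an atom ranges over all values of [w] within [delta] of the
    approximation at [e]; by the premise this range contains the exact value [h e].  Hence
    the universal perturbation implies the atom (instantiate [w] by [h e]) and the
    existential one follows from it ([h e] is the witness).  Once a variable [w] with
    [h e = w] is introduced, the only remaining facts are statements of real
    arithmetic, and the argument for an atom is an induction on the eliminated
    applications; it lifts through conjunctions, disjunctions and bounded quantifiers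
    by monotonicity.  The reasoning uses only natural deduction rules that are both
    derivable in dL and valid for semantic consequence, so it is carried out for an
    abstract entailment relation, which yields soundness and derivability at once. *)
Require Import Defs.
From Stdlib Require Import QArith List.
From Stdlib Require Import Reals Qreals Arith Lra Lia.
Import ListNotations.
Local Open Scope R_scope.

(** * Modality-free formulas and substitution in them *)

(** Function symbols are allowed here, unlike in [fol_R], but modalities are not: substitution into
    such formulas is always admissible, and their truth obeys simple coincidence and substitution
    lemmas. The bounded formula and its perturbations lie in this class. *)
Fixpoint modality_free (P : fml) : Prop :=
  match P with
  | fCmp _ _ _ => True
  | fNot P | fAll _ P | fEx _ P => modality_free P
  | fAnd P R | fOr P R | fImp P R => modality_free P /\ modality_free R
  | fBox _ _ _ | fDia _ _ _ => False
  end.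

Lemma fol_R_modality_free P : fol_R P -> modality_free P.
Proof. induction P; simpl; tauto. Qed.

Lemma modality_free_wf P : modality_free P -> wf P.
Proof. induction P; simpl; tauto. Qed.

Lemma modality_free_adm P : modality_free P -> forall s, adm s P.
Proof. induction P; simpl; intros H s; try tauto; try (destruct H; split); auto. Qed.

Lemma modality_free_subst P : modality_free P -> forall s, modality_free (subst s P).
Proof. induction P; simpl; intros H s; try tauto; try (destruct H; split); auto. Qed.

Lemma upd_same {A : Type} (w : var -> A) x a : upd w x a x = a.
Proof. unfold upd. now destruct (Nat.eq_dec x x). Qed.

Lemma upd_other {A : Type} (w : var -> A) x a y : y <> x -> upd w x a y = w y.
Proof. unfold upd. now destruct (Nat.eq_dec y x). Qed.

Lemma sub1_same x e : sub1 x e x = e.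
Proof. apply upd_same. Qed.

Lemma sub1_other x e y : y <> x -> sub1 x e y = tVar y.
Proof. apply upd_other. Qed.

Lemma fresh_not_in l : ~ In (fresh l) l.
Proof.
  intro H. pose proof (proj1 (list_max_le l _) (le_n _)) as M.
  rewrite Forall_forall in M. apply M in H. unfold fresh in H. lia.
Qed.

Lemma in_remove_neq (x y : var) l : In y l -> y <> x -> In y (remove Nat.eq_dec x l).
Proof. intros. now apply in_in_remove. Qed.

Lemma eval_ext t w v : (forall x, In x (tvars t) -> w x = v x) -> eval w t = eval v t.
Proof.
  induction t; simpl; intros H; auto; try (now rewrite IHt by auto);
  rewrite IHt1, IHt2; auto; intros; apply H, in_app_iff; auto.
Qed.

Lemma eval_tsubst t w s : eval w (tsubst s t) = eval (fun x => eval w (s x)) t.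
Proof. induction t; simpl; congruence. Qed.

Lemma tsubst_id t s : (forall x, In x (tvars t) -> s x = tVar x) -> tsubst s t = t.
Proof.
  induction t; simpl; intros H; auto; try (now rewrite IHt by auto);
  rewrite IHt1, IHt2; auto; intros; apply H, in_app_iff; auto.
Qed.

Lemma tsubst_tsubst t s r : tsubst r (tsubst s t) = tsubst (fun x => tsubst r (s x)) t.
Proof. induction t; simpl; congruence. Qed.

Lemma no_fsym_tsubst t s : (forall x, no_fsym (s x)) -> no_fsym t -> no_fsym (tsubst s t).
Proof. induction t; simpl; intuition. Qed.

Lemma no_fsym_sub1 x e : no_fsym e -> forall y, no_fsym (sub1 x e y).
Proof. intros H y. unfold sub1, upd. destruct (Nat.eq_dec y x); simpl; auto. Qed.

Lemma fol_R_subst P : fol_R P -> forall s, (forall x, no_fsym (s x)) -> fol_R (subst s P).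
Proof.
  induction P; simpl; intros H s Hs; try tauto; try (destruct H; split); auto;
    try (now apply no_fsym_tsubst);
    apply IHP; auto; intro y; unfold upd; destruct (Nat.eq_dec y x); simpl; auto.
Qed.

Lemma sat_ext P : modality_free P -> forall w v,
  (forall x, In x (fv P) -> w x = v x) -> (sat w P <-> sat v P).
Proof.
  induction P; simpl; intros HP w v H; try tauto.
  - rewrite (eval_ext p w v), (eval_ext q w v); try tauto;
      intros; apply H, in_app_iff; auto.
  - rewrite (IHP HP w v); tauto.
  - rewrite (IHP1 (proj1 HP) w v), (IHP2 (proj2 HP) w v); try tauto;
      intros; apply H, in_app_iff; auto.
  - rewrite (IHP1 (proj1 HP) w v), (IHP2 (proj2 HP) w v); try tauto;
      intros; apply H, in_app_iff; auto.
  - rewrite (IHP1 (proj1 HP) w v), (IHP2 (proj2 HP) w v); try tauto;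
      intros; apply H, in_app_iff; auto.
  - assert (E : forall a, sat (upd w x a) P <-> sat (upd v x a) P).
    { intro a. apply IHP; auto. intros y Hy. destruct (Nat.eq_dec y x) as [->|n].
      - now rewrite !upd_same.
      - rewrite !upd_other by auto. apply H. now apply in_remove_neq. }
    split; intros K a; apply E, K.
  - assert (E : forall a, sat (upd w x a) P <-> sat (upd v x a) P).
    { intro a. apply IHP; auto. intros y Hy. destruct (Nat.eq_dec y x) as [->|n].
      - now rewrite !upd_same.
      - rewrite !upd_other by auto. apply H. now apply in_remove_neq. }
    split; intros [a K]; exists a; apply E, K.
Qed.

(** If [x] would capture nothing, it is kept and is absent from the relevant terms; otherwise the
    new name is fresh for all of them. *)
Lemma binder_fresh s x P y :
  In y (fv P) -> y <> x -> ~ In (binder s x P) (tvars (s y)).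
Proof.
  intros Hy n Hin. unfold binder in Hin.
  set (l := flat_map _ _) in Hin.
  assert (K : forall z, In z (tvars (s y)) -> In z l).
  { intros z Hz. apply in_flat_map. exists y. split; auto. now apply in_remove_neq. }
  destruct (in_dec Nat.eq_dec x l) as [i|i].
  - exact (fresh_not_in l (K _ Hin)).
  - exact (i (K _ Hin)).
Qed.

Lemma sat_subst P : modality_free P -> forall w s,
  sat w (subst s P) <-> sat (fun x => eval w (s x)) P.
Proof.
  (* Under a quantifier the renamed variable carries the value [a]. It occurs in no [s y] for
     another free variable [y], so updating it leaves those values alone. *)
  assert (B : forall x P w s a, modality_free P ->
    sat (fun y => eval (upd w (binder s x P) a) (upd s x (tVar (binder s x P)) y)) P <->
    sat (upd (fun y => eval w (s y)) x a) P).
  { intros x R w s a HR. apply sat_ext; auto. intros y Hy.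
    destruct (Nat.eq_dec y x) as [->|n].
    - rewrite !upd_same. simpl. now rewrite upd_same.
    - rewrite !upd_other by auto. apply eval_ext. intros z Hz. apply upd_other.
      intros ->. exact (binder_fresh s x R y Hy n Hz). }
  induction P; simpl; intros HP w s; try tauto.
  - now rewrite !eval_tsubst.
  - rewrite (IHP HP). tauto.
  - rewrite (IHP1 (proj1 HP)), (IHP2 (proj2 HP)). tauto.
  - rewrite (IHP1 (proj1 HP)), (IHP2 (proj2 HP)). tauto.
  - rewrite (IHP1 (proj1 HP)), (IHP2 (proj2 HP)). tauto.
  - split; intros K a; specialize (K a); [rewrite (IHP HP) in K|rewrite (IHP HP)];
      now apply B.
  - split; intros [a K]; exists a; [rewrite (IHP HP) in K|rewrite (IHP HP)];
      now apply B.
Qed.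

(** Syntactic equality holds although [subst] can rename binders: where the substitution fixes all
    free variables nothing is captured, so [binder] keeps the old name. *)
Lemma subst_id P : modality_free P -> forall s,
  (forall x, In x (fv P) -> s x = tVar x) -> subst s P = P.
Proof.
  assert (B : forall s x P, (forall y, In y (remove Nat.eq_dec x (fv P)) -> s y = tVar y) ->
    binder s x P = x /\ forall y, In y (fv P) -> upd s x (tVar x) y = tVar y).
  { intros s x R H. split.
    - unfold binder. destruct (in_dec _ _ _) as [i|]; auto. exfalso.
      apply in_flat_map in i. destruct i as [z [Hz Hi]].
      rewrite H in Hi by auto. destruct Hi as [->|[]]. now apply remove_In in Hz.
    - intros y Hy. destruct (Nat.eq_dec y x) as [->|n].
      + apply upd_same.
      + rewrite upd_other by auto. apply H. now apply in_remove_neq. }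
  induction P; simpl; intros HP s H; try tauto;
    try (rewrite IHP1, IHP2 by (tauto || (intros; apply H, in_app_iff; auto)); reflexivity).
  - rewrite !tsubst_id; auto; intros; apply H, in_app_iff; auto.
  - now rewrite IHP.
  - destruct (B s x P H) as [-> E]. now rewrite IHP.
  - destruct (B s x P H) as [-> E]. now rewrite IHP.
Qed.

Lemma subst_sub1_self P x : modality_free P -> subst (sub1 x (tVar x)) P = P.
Proof.
  intro H. apply subst_id; auto. intros y _. unfold sub1.
  destruct (Nat.eq_dec y x) as [->|n]; [apply upd_same|now apply upd_other].
Qed.

(** * Abstract entailment, with semantic consequence and dL provability as instances *)

(** The rules are single-conclusion natural deduction. Restricting to modality-free formulas serves
    both instances: semantically it gives access to [sat_ext] and [sat_subst], and in the calculus
    it makes substitutions admissible. Arithmetic enters only through [t_real], which excludes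
    function symbols. *)
Record entailment (T : list fml -> fml -> Prop) : Prop := {
  t_hyp G P : In P G -> T G P;
  t_weak G G' P : T G P -> incl G G' -> T G' P;
  t_impI G P R : T (P :: G) R -> T G (fImp P R);
  t_impE G P R : T G (fImp P R) -> T G P -> T G R;
  t_andI G P R : T G P -> T G R -> T G (fAnd P R);
  t_andE1 G P R : T G (fAnd P R) -> T G P;
  t_andE2 G P R : T G (fAnd P R) -> T G R;
  t_orI1 G P R : T G P -> T G (fOr P R);
  t_orI2 G P R : T G R -> T G (fOr P R);
  t_orE G P R S : T G (fOr P R) -> T (P :: G) S -> T (R :: G) S -> T G S;
  t_allI G x P :
    (forall R, In R G -> modality_free R /\ ~ In x (fv R)) ->
    T G P -> T G (fAll x P);
  t_allE G x P e : modality_free P -> T G (fAll x P) -> T G (subst (sub1 x e) P);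
  t_exI G x P e : modality_free P -> T G (subst (sub1 x e) P) -> T G (fEx x P);
  t_exE G x P S :
    (forall R, In R (S :: G) -> modality_free R /\ ~ In x (fv R)) ->
    T G (fEx x P) -> T (P :: G) S -> T G S;
  t_real G P :
    (forall R, In R (P :: G) -> fol_R R) ->
    (forall w, (forall R, In R G -> sat w R) -> sat w P) -> T G P;
  t_eq x a b P :
    modality_free P ->
    T [] (fImp (fEq a b) (fImp (subst (sub1 x a) P) (subst (sub1 x b) P)))
}.

Lemma consequence_entailment :
  entailment (fun G P => forall w, (forall R, In R G -> sat w R) -> sat w P).
Proof.
  (* Changing a variable that is free in no side formula does not affect their truth; this justifies
     both eigenvariable rules. *)
  assert (U : forall (G : list fml) w x a,
    (forall R, In R G -> modality_free R /\ ~ In x (fv R)) ->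
    (forall R, In R G -> (sat (upd w x a) R <-> sat w R))).
  { intros G w x a H R HR. destruct (H R HR) as [M N]. apply sat_ext; auto.
    intros y Hy. apply upd_other. now intros ->. }
  split; simpl; try (intros; intuition; fail).
  - intros G P R H w HG HP. apply H. intros Q [<-|HQ]; auto.
  - intros G P R H w HG. now apply H.
  - intros G P R H w HG. now apply H.
  - intros G P R S H H1 H2 w HG.
    destruct (H w HG); [apply H1|apply H2]; intros Q [<-|HQ]; auto.
  - intros G x P HG H w Hw a. apply H. intros R HR. apply (U G); auto.
  - intros G x P e HP H w HG. rewrite sat_subst by auto.
    apply (sat_ext P HP (upd w x (eval w e))); auto.
    intros y _. unfold sub1, upd. now destruct (Nat.eq_dec y x).
  - intros G x P e HP H w HG. exists (eval w e). specialize (H w HG).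
    rewrite sat_subst in H by auto. revert H. apply sat_ext; auto.
    intros y _. unfold sub1, upd. now destruct (Nat.eq_dec y x).
  - intros G x P S HS H1 H2 w HG. destruct (H1 w HG) as [a Ha].
    apply (U (S :: G) w x a); simpl; auto. apply H2.
    intros R [<-|HR]; auto. apply (U (S :: G)); simpl; auto.
  - intros x a b P HP w _ E. rewrite !sat_subst by auto. apply sat_ext; auto.
    intros y _. unfold sub1, upd. destruct (Nat.eq_dec y x); auto.
Qed.

(** Transfers what is provable without premises, such as the conditions of a provable enclosure, to
    derivations from the premise of the rules. *)
Lemma prov_mono H G D : prov H G D -> forall H', incl H H' -> prov H' G D.
Proof.
  induction 1; intros H' HH;
    [ apply pr_hyp; now apply HH
    | apply pr_id | eapply pr_struct | eapply pr_cut | apply pr_notL | apply pr_notR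
    | apply pr_andL | apply pr_andR | apply pr_orL | apply pr_orR | apply pr_impL
    | apply pr_impR | eapply pr_allL | apply pr_allR | apply pr_exL | eapply pr_exR
    | apply pr_real | apply pr_axiom | apply pr_G | apply pr_dW | eapply pr_dC
    | apply pr_FI ]; eauto.
Qed.

Lemma incl_nil (A : Type) (l : list A) : incl [] l.
Proof. intros a []. Qed.

Ltac solve_incl := let y := fresh "y" in intro y; simpl; tauto.

Lemma prov_cut1 H G P R : prov H G [P] -> prov H (P :: G) [R] -> prov H G [R].
Proof.
  intros H1 H2. apply (pr_cut H G [R] P); auto.
  apply pr_struct with (1 := H1); solve_incl.
Qed.

Lemma prov_assumption H G D P : In P G -> In P D -> prov H G D.
Proof.
  intros HG HD. apply pr_struct with (1 := pr_id H P); intros y [<-|[]]; auto.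
Qed.

Lemma prov_entailment H : entailment (fun G P => prov H G [P]).
Proof.
  split; intros; try rename R2 into R0.
  - apply prov_assumption with P; simpl; auto.
  - apply pr_struct with (1 := H0); auto. solve_incl.
  - now apply pr_impR.
  - apply prov_cut1 with (1 := H0). apply pr_impL.
    + apply pr_struct with (1 := H1); solve_incl.
    + apply prov_assumption with R0; simpl; auto.
  - now apply pr_andR.
  - apply prov_cut1 with (1 := H0). apply pr_andL.
    apply prov_assumption with P; simpl; auto.
  - apply prov_cut1 with (1 := H0). apply pr_andL.
    apply prov_assumption with R0; simpl; auto.
  - apply pr_orR. apply pr_struct with (1 := H0); solve_incl.
  - apply pr_orR. apply pr_struct with (1 := H0); solve_incl.
  - apply prov_cut1 with (1 := H0). now apply pr_orL.
  - apply pr_struct with (G := G) (D := [fAll x P]); try solve_incl.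
    apply prov_cut1 with (P := fAll x P).
    + apply pr_allR.
      * rewrite app_nil_r. intro K. apply in_flat_map in K.
        destruct K as [R [HR HK]]. exact (proj2 (H0 R HR) HK).
      * assumption.
    + apply prov_assumption with (fAll x P); simpl; auto.
  - apply prov_cut1 with (1 := H1). apply pr_allL with e.
    + now apply modality_free_adm.
    + apply prov_assumption with (subst (sub1 x e) P); simpl; auto.
  - apply pr_exR with e; auto. now apply modality_free_adm.
  - apply prov_cut1 with (1 := H1). apply pr_exL; auto.
    intro K. apply in_flat_map in K. destruct K as [R [HR HK]].
    apply in_app_iff in HR. simpl in HR.
    refine (proj2 (H0 R _) HK). simpl. tauto.
  - apply pr_real.
    + intros R HR. apply H0. apply in_app_iff in HR. simpl in *. tauto.
    + intros w Hw. exists P. simpl. auto.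
  - apply pr_axiom.
    + apply ax_eq; now apply modality_free_adm.
    + simpl. repeat split; now apply modality_free_wf, modality_free_subst.
Qed.

(** * Rational constants and the elimination of function applications from terms *)

Lemma Q2R_opp1 : Q2R (-1) = -1.
Proof. unfold Q2R. simpl. lra. Qed.

Lemma Q2R_zero : Q2R 0 = 0.
Proof. unfold Q2R. simpl. lra. Qed.

(** As [w] is new to [t], its occurrences after the replacement mark exactly the removed
    applications, so substituting back recovers [t]. *)
Lemma tsubst_sub1_replace h e w t :
  ~ In w (tvars t) -> tsubst (sub1 w (tApp h e)) (replace h e w t) = t.
Proof.
  induction t as [x|c|s IHs u IHu|s IHs u IHu|k s IHs]; cbn [replace tvars]; intro H.
  - cbn [tsubst]. unfold sub1. rewrite upd_other; auto. intros ->. apply H. simpl. auto.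
  - reflexivity.
  - cbn [tsubst]. rewrite IHs, IHu; auto; intro K; apply H, in_app_iff; auto.
  - cbn [tsubst]. rewrite IHs, IHu; auto; intro K; apply H, in_app_iff; auto.
  - destruct (term_eq_dec (tApp k s) (tApp h e)) as [E|E]; cbn [tsubst].
    + now rewrite sub1_same.
    + now rewrite IHs.
Qed.

Lemma tsubst_sub1_fresh w a t : ~ In w (tvars t) -> tsubst (sub1 w a) t = t.
Proof.
  intro H. apply tsubst_id. intros x Hx. unfold sub1. apply upd_other. now intros ->.
Qed.

Lemma tvars_replace h e w t x :
  In x (tvars (replace h e w t)) -> x = w \/ In x (tvars t).
Proof.
  induction t as [y|c|s IHs u IHu|s IHs u IHu|k s IHs]; cbn [replace tvars]; auto;
    try (rewrite !in_app_iff; tauto).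
  destruct (term_eq_dec (tApp k s) (tApp h e)) as [E|E]; auto.
  simpl. intros [->|[]]. auto.
Qed.

Lemma subterms_refl t : In t (subterms t).
Proof. destruct t; simpl; auto. Qed.

(** Enclosures and approximations are indexed by terms of the original formula. After an elimination
    each subterm still stands for such a term, with [w] standing for [tApp h e]. *)
Lemma subterms_replace h e w t s : ~ In w (tvars t) ->
  In s (subterms (replace h e w t)) -> In (tsubst (sub1 w (tApp h e)) s) (subterms t).
Proof.
  induction t as [y|c|t1 IH1 t2 IH2|t1 IH1 t2 IH2|k u IH]; intros Hw Hs.
  - simpl in Hs. destruct Hs as [<-|[]]. rewrite tsubst_sub1_fresh; simpl in *; auto.
  - simpl in Hs. destruct Hs as [<-|[]]. simpl. auto.
  - pose proof (tsubst_sub1_replace h e w (tAdd t1 t2) Hw) as E. cbn [replace] in *.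
    destruct Hs as [<-|Hs]; [rewrite E; apply subterms_refl|].
    simpl in *. rewrite in_app_iff in *. tauto.
  - pose proof (tsubst_sub1_replace h e w (tMul t1 t2) Hw) as E. cbn [replace] in *.
    destruct Hs as [<-|Hs]; [rewrite E; apply subterms_refl|].
    simpl in *. rewrite in_app_iff in *. tauto.
  - pose proof (tsubst_sub1_replace h e w (tApp k u) Hw) as E.
    cbn [replace] in *.
    destruct (term_eq_dec (tApp k u) (tApp h e)) as [Eq|Eq].
    + simpl in Hs. destruct Hs as [<-|[]]. rewrite E. apply subterms_refl.
    + destruct Hs as [<-|Hs]; [rewrite E; apply subterms_refl|].
      simpl. right. auto.
Qed.

Lemma subterms_tvars s t : In s (subterms t) -> incl (tvars s) (tvars t).
Proof.
  induction t; simpl; intros [<-|H]; try apply incl_refl; try contradiction.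
  1,2: apply in_app_iff in H; destruct H as [H|H];
    [apply incl_appl|apply incl_appr]; auto.
  auto.
Qed.

Lemma subterms_trans s t u :
  In s (subterms t) -> In t (subterms u) -> In s (subterms u).
Proof.
  intro Hs. induction u; simpl; intros [<-|H]; try (exact Hs); try contradiction;
    right; try (apply in_app_iff in H; apply in_app_iff; destruct H); auto.
Qed.

(** * Enclosures, graphs of approximations and interval contexts *)

Lemma sat_fin w e J : sat w (fin e J) <-> rin (eval w e) J.
Proof. reflexivity. Qed.

(** [th] maps the variables introduced for function applications to these
    applications, so that [tsubst th e] is the term of [ph] from which [e] arose. *)
Lemma enclosure_eval eps I ph e (th : var -> term) w :
  enclosure eps I ph -> no_fsym e ->
  (forall s, In s (subterms e) -> In (tsubst th s) (bterms ph)) ->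
  (forall x, In x (tvars e) -> rin (w x) (I (th x))) ->
  rin (eval w e) (I (tsubst th e)).
Proof.
  intros (Hc & _ & Ha & Hm & _).
  induction e; simpl; intros He Hs Hw; auto; try contradiction.
  - apply Hc, (Hs (tConst c)). auto.
  - apply Ha; [apply (Hs (tAdd e1 e2)); auto| |].
    + apply IHe1; try tauto; intros; [apply Hs|apply Hw]; rewrite ?in_app_iff; auto.
    + apply IHe2; try tauto; intros; [apply Hs|apply Hw]; rewrite ?in_app_iff; auto.
  - apply Hm; [apply (Hs (tMul e1 e2)); auto| |].
    + apply IHe1; try tauto; intros; [apply Hs|apply Hw]; rewrite ?in_app_iff; auto.
    + apply IHe2; try tauto; intros; [apply Hs|apply Hw]; rewrite ?in_app_iff; auto.
Qed.

(** Truth of [G] depends on variables 0 and 1 alone; the constant state 0 is an arbitrary default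
    for the others. *)
Lemma sat_graph G e z w : fol_R G -> incl (fv G) [0%nat; 1%nat] ->
  sat w (graph G e z) <->
  sat (upd (upd (fun _ => 0) 0%nat (eval w e)) 1%nat (eval w z)) G.
Proof.
  intros HG HV. unfold graph. rewrite sat_subst by now apply fol_R_modality_free.
  apply sat_ext; [now apply fol_R_modality_free|].
  intros x Hx. apply HV in Hx. destruct Hx as [<-|[<-|[]]]; reflexivity.
Qed.

(** Freshness of [z] for [e] preserves the argument when [z] is assigned. In this form, formulas
    that bind the value under different names can be compared. *)
Lemma sat_with_value G e l K w : fol_R G -> incl (fv G) [0%nat; 1%nat] ->
  let z := fresh (tvars e ++ l) in
  sat w (with_value G e l K) <->
  exists c, sat (upd (upd (fun _ => 0) 0%nat (eval w e)) 1%nat c) G /\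
            sat (upd w z c) (K (tVar z)).
Proof.
  intros HG HV z. unfold with_value. fold z. cbn [sat].
  assert (E : forall c, eval (upd w z c) e = eval w e).
  { intro c. apply eval_ext. intros x Hx. apply upd_other. intros ->.
    apply (fresh_not_in (tvars e ++ l)). fold z. apply in_app_iff. auto. }
  split; intros [c Hc]; exists c; revert Hc; rewrite sat_graph by auto; rewrite E;
    cbn [eval]; rewrite upd_same; auto.
Qed.

Lemma fol_R_graph G e z : fol_R G -> no_fsym e -> no_fsym z -> fol_R (graph G e z).
Proof.
  intros HG He Hz. apply fol_R_subst; auto.
  intro x. simpl. unfold upd.
  destruct (Nat.eq_dec x 0); auto. destruct (Nat.eq_dec x 1); simpl; auto.
Qed.

(** [P] is meant as a perturbation and [A] as the original formula, so that a single induction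
    covers both rules. *)
Definition imp_dir (q : quant) (P A : fml) : fml :=
  match q with QAll => fImp P A | QEx => fImp A P end.

(** [th x] is the term of the bounded formula for which [x] stands: the variable itself, or a
    function application if [x] was introduced by an elimination. *)
Definition ctx (I : term -> QIntv) (th : var -> term) (l : list var) : list fml :=
  map (fun x => fin (tVar x) (I (th x))) l.

Lemma sat_ctx I th l w :
  (forall R, In R (ctx I th l) -> sat w R) <->
  forall x, In x l -> rin (w x) (I (th x)).
Proof.
  split; intros H.
  - intros x Hx. change (sat w (fin (tVar x) (I (th x)))).
    apply H, in_map_iff. exists x. auto.
  - intros R HR. apply in_map_iff in HR. destruct HR as (x & <- & Hx).
    exact (H x Hx).
Qed.

Lemma ctx_fol_R I th l R : In R (ctx I th l) -> fol_R R.
Proof.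
  intro H. apply in_map_iff in H. destruct H as (x & <- & _). simpl. tauto.
Qed.

Lemma ctx_fresh I th l x : ~ In x l ->
  forall R, In R (ctx I th l) -> modality_free R /\ ~ In x (fv R).
Proof.
  intros H R HR. split; [now apply fol_R_modality_free, (ctx_fol_R I th l)|].
  apply in_map_iff in HR. destruct HR as (y & <- & Hy). simpl.
  intros [->|[->|[]]]; auto.
Qed.

Lemma ctx_incl I th l l' : incl l l' -> incl (ctx I th l) (ctx I th l').
Proof. intros H. now apply incl_map. Qed.

Lemma atom_fml_modality_free a : modality_free (atom_fml a).
Proof. destruct a as [[] t]; simpl; exact Logic.I. Qed.

Lemma atom_fml_fv r t : incl (fv (atom_fml (r, t))) (tvars t).
Proof. destruct r; simpl; rewrite app_nil_r; apply incl_refl. Qed.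

Lemma subst_atom_fml s r t : subst s (atom_fml (r, t)) = atom_fml (r, tsubst s t).
Proof. destruct r; reflexivity. Qed.

(** * Derived rules of an entailment relation *)

Section Entailment.
Variable T : list fml -> fml -> Prop.
Hypothesis HT : entailment T.

Lemma t_nil G P : T [] P -> T G P.
Proof. intro H. apply (t_weak T HT) with (1 := H). intros a []. Qed.

Lemma t_cut G P R : T G P -> T (P :: G) R -> T G R.
Proof. intros H1 H2. apply (t_impE T HT) with P; auto. now apply (t_impI T HT). Qed.

Lemma t_allE_self G x P : modality_free P -> T G (fAll x P) -> T G P.
Proof.
  intros HP H. rewrite <- (subst_sub1_self P x) by auto. now apply (t_allE T HT).
Qed.

Lemma t_exI_self G x P : modality_free P -> T G P -> T G (fEx x P).
Proof.
  intros HP H. apply (t_exI T HT) with (tVar x); auto. now rewrite subst_sub1_self.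
Qed.

Lemma t_inst x e P : modality_free P -> T [] P -> T [] (subst (sub1 x e) P).
Proof.
  intros HP H. apply (t_allE T HT); auto. apply (t_allI T HT); auto. intros R [].
Qed.

(** [e] may contain function symbols, to which [t_real] does not apply; reflexivity is therefore
    obtained for a variable and then instantiated. *)
Lemma t_eq_refl e : T [] (fEq e e).
Proof.
  apply (t_inst 0%nat e (fEq (tVar 0%nat) (tVar 0%nat))); simpl; auto.
  apply (t_real T HT); simpl; auto. intros R [<-|[]]. simpl. auto.
Qed.

Lemma t_eq_subst G x a b P : modality_free P ->
  T G (fEq a b) -> T G (subst (sub1 x a) P) -> T G (subst (sub1 x b) P).
Proof.
  intros HP H1 H2. apply (t_impE T HT) with (2 := H2).
  apply (t_impE T HT) with (2 := H1). apply t_nil. now apply (t_eq T HT).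
Qed.

Lemma t_eq_sym G a b : T G (fEq a b) -> T G (fEq b a).
Proof.
  (* Leibniz's rule is applied to the formula [x = a], whose right side is untouched because [x] is
     fresh for [a]. *)
  intro H. set (x := fresh (tvars a)).
  assert (Hx : ~ In x (tvars a)) by apply fresh_not_in.
  assert (E : forall c, subst (sub1 x c) (fEq (tVar x) a) = fEq c a).
  { intro c. cbn. rewrite tsubst_sub1_fresh by auto. now rewrite sub1_same. }
  rewrite <- (E b). apply t_eq_subst with a; [exact Logic.I|auto|].
  rewrite E. apply t_nil, t_eq_refl.
Qed.

Lemma t_big_and_elim G l P : T G (big_and l) -> In P l -> T G P.
Proof.
  induction l as [|A l IH]; simpl; intros H; [tauto|].
  intros [<-|K].
  - now apply (t_andE1 T HT) in H.
  - apply (t_andE2 T HT) in H. auto.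
Qed.

Lemma t_imp_dir_hyp q G P A :
  T G (imp_dir q P A) -> forall G', incl G G' ->
  match q with
  | QAll => T G' P -> T G' A
  | QEx => T G' A -> T G' P
  end.
Proof.
  intros H G' HG. assert (K := t_weak T HT _ _ _ H HG).
  destruct q; intro K'; now apply (t_impE T HT) with (1 := K).
Qed.

Lemma t_imp_and G P P' A A' :
  T G (fImp P A) -> T G (fImp P' A') -> T G (fImp (fAnd P P') (fAnd A A')).
Proof.
  intros H H'. apply (t_impI T HT).
  assert (K : T (fAnd P P' :: G) (fAnd P P')) by (apply (t_hyp T HT); simpl; auto).
  assert (W : incl G (fAnd P P' :: G)) by solve_incl.
  apply (t_andI T HT).
  - apply (t_impE T HT) with P; [now apply (t_weak T HT) with (1 := H)|].
    now apply (t_andE1 T HT) in K.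
  - apply (t_impE T HT) with P'; [now apply (t_weak T HT) with (1 := H')|].
    now apply (t_andE2 T HT) in K.
Qed.

Lemma t_imp_or G P P' A A' :
  T G (fImp P A) -> T G (fImp P' A') -> T G (fImp (fOr P P') (fOr A A')).
Proof.
  intros H H'. apply (t_impI T HT).
  apply (t_orE T HT) with P P'; [apply (t_hyp T HT); simpl; auto| |].
  - apply (t_orI1 T HT), (t_impE T HT) with P; [|apply (t_hyp T HT); simpl; auto].
    apply (t_weak T HT) with (1 := H). solve_incl.
  - apply (t_orI2 T HT), (t_impE T HT) with P'; [|apply (t_hyp T HT); simpl; auto].
    apply (t_weak T HT) with (1 := H'). solve_incl.
Qed.

Lemma t_imp_refl G P : T G (fImp P P).
Proof. apply (t_impI T HT), (t_hyp T HT). simpl. auto. Qed.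

Lemma t_imp_dir_and q G P P' A A' :
  T G (imp_dir q P A) -> T G (imp_dir q P' A') ->
  T G (imp_dir q (fAnd P P') (fAnd A A')).
Proof. destruct q; apply t_imp_and. Qed.

Lemma t_imp_dir_or q G P P' A A' :
  T G (imp_dir q P A) -> T G (imp_dir q P' A') ->
  T G (imp_dir q (fOr P P') (fOr A A')).
Proof. destruct q; apply t_imp_or. Qed.

Lemma t_imp_dir_refl q G P : T G (imp_dir q P P).
Proof. destruct q; apply t_imp_refl. Qed.

(** The implication between the bodies may use the bounds on [y]; they will supply the enclosure of
    [y] to the induction hypothesis. *)
Lemma t_bquant_mono G k y a b P A :
  modality_free P -> modality_free A ->
  (forall R, In R G -> modality_free R /\ ~ In y (fv R)) ->
  T (fAnd (fLe a (tVar y)) (fLe (tVar y) b) :: G) (fImp P A) ->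
  T G (fImp (bquant k y a b P) (bquant k y a b A)).
Proof.
  intros HP HA HG H. set (N := fAnd (fLe a (tVar y)) (fLe (tVar y) b)) in *.
  assert (B : forall k P, modality_free P -> modality_free (bquant k y a b P) /\
                          ~ In y (fv (bquant k y a b P))).
  { intros k' P' HP'. destruct k'; split; simpl; auto; apply remove_In. }
  apply (t_impI T HT). destruct k; cbn [bquant]; fold N.
  - apply (t_allI T HT).
    + intros R [<-|HR]; auto. apply (B QAll P HP).
    + apply (t_impI T HT), (t_impE T HT) with P.
      * apply (t_weak T HT) with (1 := H). solve_incl.
      * apply (t_impE T HT) with N; [|apply (t_hyp T HT); simpl; auto].
        apply t_allE_self with y; [simpl; auto|]. apply (t_hyp T HT). simpl. auto.
  - apply (t_exE T HT) with y (fAnd N P).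
    + intros R [<-|[<-|HR]]; auto; [apply (B QEx A HA)|apply (B QEx P HP)].
    + apply (t_hyp T HT). simpl. auto.
    + apply t_exI_self; [simpl; auto|].
      assert (K : T (fAnd N P :: fEx y (fAnd N P) :: G) (fAnd N P))
        by (apply (t_hyp T HT); simpl; auto).
      assert (KN := t_andE1 T HT _ _ _ K). assert (KP := t_andE2 T HT _ _ _ K).
      apply (t_andI T HT); auto. apply (t_impE T HT) with (2 := KP).
      apply t_cut with (1 := KN). apply (t_weak T HT) with (1 := H). solve_incl.
Qed.

(** [ys] collects the variables already introduced. The bounds of [forall_in x] are literally the
    entry of [ctx] for [x], so each quantifier moves one entry into the context. *)
Lemma t_foralls_in I xs : forall ys G,
  NoDup (xs ++ ys) -> T (ctx I tVar (xs ++ ys)) G ->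
  T (ctx I tVar ys) (foralls_in I xs G).
Proof.
  induction xs as [|x xs IH]; simpl; intros ys G Hnd H; auto.
  inversion_clear Hnd as [|? ? Hx Hn].
  unfold forall_in, bquant. apply (t_allI T HT).
  - apply ctx_fresh. intro K. apply Hx, in_app_iff. auto.
  - apply (t_impI T HT). apply (IH (x :: ys) G).
    + apply Permutation.Permutation_NoDup with (x :: xs ++ ys).
      * apply Permutation.Permutation_middle.
      * now constructor.
    + apply (t_weak T HT) with (1 := H).
      apply (ctx_incl I tVar (x :: xs ++ ys)). intros z. rewrite in_app_iff. simpl.
      rewrite in_app_iff. tauto.
Qed.

(** * The perturbation argument inside an entailment relation *)

Section Perturbation.
Variables (ph : bfml) (F : approx) (delta : Q) (I : term -> QIntv).
Hypothesis HF : approximation F ph.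
Hypothesis HI : enclosure 1 I ph.
Hypothesis Hprem : T [] (delta_premise F delta I ph).
(** This condition mentions function symbols, so it must hold inside [T]. The other enclosure
    conditions enter through real arithmetic, for which the semantic [HI] suffices. *)
Hypothesis Henc : forall h e, In (tApp h e) (bterms ph) ->
  T [] (forall_in 0%nat (I e)
         (bquant QAll 1%nat (tConst (- (1))) (tConst 1)
           (fin (tAdd (tApp h (tVar 0%nat)) (tVar 1%nat)) (I (tApp h e))))).

Lemma bterms_bapps h e : In (tApp h e) (bterms ph) -> In (h, e) (bapps ph).
Proof.
  intro H. unfold bapps. apply in_flat_map. exists (tApp h e). simpl. auto.
Qed.

Lemma approx_app h e : In (tApp h e) (bterms ph) ->
  fol_R (F (tApp h e)) /\ incl (fv (F (tApp h e))) [0%nat; 1%nat].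
Proof. intro H. destruct (HF h e (bterms_bapps h e H)) as (A & B & _). auto. Qed.

(** The matrix of the premise for [u := h s]; with a variable for [u] it becomes a
    formula of real arithmetic. *)
Definition approx_within (G : fml) (u : term) : fml :=
  with_value G (tVar 0%nat) [0%nat] (fun v =>
    fAnd (fLe (tConst (- delta)) (tSub v u)) (fLe (tSub v u) (tConst delta))).

Lemma fol_R_approx_within G u : fol_R G -> no_fsym u -> fol_R (approx_within G u).
Proof.
  intros HG Hu. simpl. split; [apply fol_R_graph; simpl; auto|simpl; tauto].
Qed.

Lemma modality_free_approx_within G u : fol_R G -> modality_free (approx_within G u).
Proof.
  intros HG. simpl. repeat split. now apply modality_free_subst, fol_R_modality_free.
Qed.

(** Naming the value of [h] by a variable turns the premise and the enclosure condition into real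
    arithmetic. The name is variable 2 because [approx_within] binds variable 1. *)
Lemma t_app_var h e0 : In (tApp h e0) (bterms ph) ->
  T [] (fImp (fin (tVar 0%nat) (I e0))
         (fImp (fEq (tApp h (tVar 0%nat)) (tVar 2%nat))
           (fAnd (fin (tVar 2%nat) (I (tApp h e0)))
                 (approx_within (F (tApp h e0)) (tVar 2%nat))))).
Proof.
  intros Hin. destruct (approx_app h e0 Hin) as [HG HV].
  set (G := F (tApp h e0)) in *.
  apply (t_impI T HT), (t_impI T HT).
  set (C := [_; _]).
  assert (H0 : T C (fin (tVar 0%nat) (I e0))) by (apply (t_hyp T HT); simpl; auto).
  assert (HE : T C (fEq (tApp h (tVar 0%nat)) (tVar 2%nat)))
    by (apply (t_hyp T HT); simpl; auto).
  apply (t_andI T HT).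
  - assert (K := t_nil C _ (Henc h e0 Hin)).
    unfold forall_in in K. apply t_allE_self in K; [|simpl; tauto].
    apply (t_impE T HT) with (2 := H0) in K.
    (* The enclosure allows any slack in [-1, 1]; slack 0 gives the value of [h] itself. *)
    apply (t_allE T HT) with (e := tConst 0) in K; [|simpl; tauto].
    cbn in K. pose proof (t_impE T HT _ _ _ K) as K'. clear K.
    lapply K'; clear K'; [intro K|apply t_nil, (t_real T HT)].
    2:{ intros R [<-|[]]. simpl. tauto. }
    2:{ intros w _. simpl. unfold Q2R. simpl. lra. }
    apply t_cut with (fin (tAdd (tVar 2%nat) (tConst 0)) (I (tApp h e0))).
    + apply (t_eq_subst C 2%nat _ _ (fin (tAdd (tVar 2%nat) (tConst 0)) (I (tApp h e0)))
               ltac:(simpl; tauto) HE K).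
    + apply (t_weak T HT) with [fin (tAdd (tVar 2%nat) (tConst 0)) (I (tApp h e0))].
      * apply (t_real T HT).
        -- intros R [<-|[<-|[]]]; simpl; tauto.
        -- intros w Hw. specialize (Hw _ (or_introl eq_refl)).
           rewrite sat_fin in *. cbn in Hw. rewrite Q2R_zero, Rplus_0_r in Hw. exact Hw.
      * intros x [<-|[]]. simpl. auto.
  - assert (K : T C (approx_within G (tApp h (tVar 0%nat)))).
    { apply (t_impE T HT) with (2 := H0). apply t_allE_self with 0%nat.
      - split; [simpl; tauto|]. now apply modality_free_approx_within.
      - apply t_nil, t_big_and_elim with (1 := Hprem).
        apply in_map_iff. exists (h, e0). split; auto. now apply bterms_bapps. }
    unfold approx_within, with_value in K. cbv zeta in K.
    (* [z] computes to variable 1, hence differs from the variables 0 and 2 of the context and the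
       conclusion. *)
    set (z := fresh _) in K.
    apply (t_exE T HT) with (2 := K).
    + intros R [<-|[<-|[<-|[]]]].
      * split; [now apply modality_free_approx_within|].
        unfold approx_within, with_value. cbv zeta. fold z. cbn [fv]. apply remove_In.
      * split; [exact Logic.I|]. simpl. intuition discriminate.
      * split; [simpl; tauto|]. simpl. intuition discriminate.
    + set (M := fAnd (graph _ _ _) _). set (C' := M :: C).
      assert (HM : T C' M) by (apply (t_hyp T HT); simpl; auto).
      assert (HE' : T C' (fEq (tApp h (tVar 0%nat)) (tVar 2%nat)))
        by (apply (t_hyp T HT); simpl; auto).
      set (M' := fAnd (graph G (tVar 0%nat) (tVar z))
        (fAnd (fLe (tConst (- delta)) (tSub (tVar z) (tVar 2%nat)))
              (fLe (tSub (tVar z) (tVar 2%nat)) (tConst delta)))).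
      assert (HM' : T C' M').
      { apply (t_andI T HT).
        - exact (t_andE1 T HT _ _ _ HM).
        - apply (t_eq_subst C' 2%nat _ _
            (fAnd (fLe (tConst (- delta)) (tSub (tVar z) (tVar 2%nat)))
                  (fLe (tSub (tVar z) (tVar 2%nat)) (tConst delta)))
               ltac:(simpl; tauto) HE' (t_andE2 T HT _ _ _ HM)). }
      apply t_exI_self with (x := z) (P := M'); auto.
      split; [now apply modality_free_subst, fol_R_modality_free|simpl; tauto].
Qed.

Definition near_range (w : var) (G : fml) (e : term) : fml :=
  with_value G e [w] (fun v =>
    fAnd (fLe (tSub v (tConst delta)) (tVar w)) (fLe (tVar w) (tAdd v (tConst delta)))).

Lemma quant_near_eq q w G e P :
  quant_near q w G e delta P =
  match q with
  | QAll => fAll w (fImp (near_range w G e) P)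
  | QEx => fEx w (fAnd (near_range w G e) P)
  end.
Proof. reflexivity. Qed.

Lemma fol_R_near_range w G e : fol_R G -> no_fsym e -> fol_R (near_range w G e).
Proof.
  intros HG Hu. simpl. split; [apply fol_R_graph; simpl; auto|simpl; tauto].
Qed.

(** [e] is the argument after inner applications have been eliminated, and [e0] is the term of [ph]
    it came from, which indexes [I] and [F]. *)
Lemma t_app_near h e e0 w C :
  In (tApp h e0) (bterms ph) -> no_fsym e -> ~ In w (tvars e) ->
  T C (fin e (I e0)) -> T C (fEq (tApp h e) (tVar w)) ->
  T C (fin (tVar w) (I (tApp h e0))) /\ T C (near_range w (F (tApp h e0)) e).
Proof.
  intros Hin He Hw HC1 HC2. destruct (approx_app h e0 Hin) as [HG HV].
  set (G := F (tApp h e0)) in *.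
  (* Variables 0 and 2 are to become [e] and [w] simultaneously. Since [e] may contain variable 2
     and [w] may be variable 0, the single substitutions pass through the intermediate name [b]. *)
  set (b := fresh (0%nat :: tvars e)).
  assert (Hb : ~ In b (0%nat :: tvars e)) by apply fresh_not_in.
  set (A := approx_within G (tVar 2%nat)).
  assert (HA : fol_R A) by (apply fol_R_approx_within; simpl; auto).
  set (S := fun P => subst (sub1 b (tVar w))
    (subst (sub1 0%nat e) (subst (sub1 2%nat (tVar b)) P))).
  set (s := fun x => tsubst (sub1 b (tVar w)) (tsubst (sub1 0%nat e) (sub1 2%nat (tVar b) x))).
  assert (E0 : s 0%nat = e).
  { unfold s. simpl. apply tsubst_sub1_fresh. intro K. apply Hb. simpl. auto. }
  assert (E2 : s 2%nat = tVar w).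
  { unfold s. rewrite sub1_same. cbn [tsubst].
    rewrite sub1_other by (intros E; apply Hb; rewrite E; simpl; auto).
    cbn [tsubst]. apply sub1_same. }
  assert (K := t_app_var h e0 Hin). fold G A in K.
  assert (MA : modality_free A) by now apply fol_R_modality_free.
  apply (t_inst 2%nat (tVar b)) in K; [|simpl; tauto].
  apply (t_inst 0%nat e) in K; [|apply modality_free_subst; simpl; tauto].
  apply (t_inst b (tVar w)) in K; [|do 2 apply modality_free_subst; simpl; tauto].
  change (T [] (fImp (fin (s 0%nat) (I e0)) (fImp (fEq (tApp h (s 0%nat)) (s 2%nat))
    (fAnd (fin (s 2%nat) (I (tApp h e0))) (S A))))) in K.
  rewrite E0, E2 in K.
  apply (t_nil C) in K.
  apply (t_impE T HT) with (2 := HC1) in K. apply (t_impE T HT) with (2 := HC2) in K.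
  split; [exact (t_andE1 T HT _ _ _ K)|].
  apply t_cut with (1 := t_andE2 T HT _ _ _ K).
  apply (t_weak T HT) with [S A]; [|intros x [<-|[]]; simpl; auto].
  (* Both formulas are now real arithmetic and bound the distance between the approximation at [e]
     and [w] by [delta]; their bound names may differ, so they are compared semantically. *)
  apply (t_real T HT).
  - intros R [<-|[<-|[]]]; [now apply fol_R_near_range|].
    repeat (apply fol_R_subst); auto; apply no_fsym_sub1; simpl; auto.
  - intros v Hv. specialize (Hv _ (or_introl eq_refl)).
    assert (HS : sat (fun x => eval v (s x)) A).
    { unfold S in Hv. rewrite !sat_subst in Hv by (repeat apply modality_free_subst; auto).
      revert Hv. apply sat_ext; auto. intros x _. unfold s. now rewrite !eval_tsubst. }
    unfold A, approx_within in HS. rewrite sat_with_value in HS by auto.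
    destruct HS as (c & H1 & H2). apply sat_with_value; auto. exists c. split.
    + cbn [eval] in H1. rewrite E0 in H1. exact H1.
    + set (z := fresh (tvars e ++ [w])) in *.
      assert (Hz : w <> z).
      { intros E. apply (fresh_not_in (tvars e ++ [w])). fold z. rewrite <- E.
        apply in_app_iff. simpl. auto. }
      revert H2. cbn [sat fLe cmp_sem eval tSub tNeg]. rewrite !upd_same.
      rewrite (upd_other v z c w) by auto.
      rewrite (upd_other _ _ c 2%nat) by (simpl; discriminate). rewrite E2. cbn [eval].
      rewrite Q2R_opp, Q2R_opp1. lra.
Qed.

(** Induction on the eliminations, with the invariant that [F'] is [F] read through [th] and that
    all subterms of the current atom are sent by [th] to terms of [ph]. A step extends [th] by
    sending [w] to the eliminated application. *)
Lemma t_perturb_atom q F' at' P : perturb_atom q delta F' at' P ->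
  forall th, (forall s, F' s = F (tsubst th s)) ->
  (forall s, In s (subterms (snd at')) -> In (tsubst th s) (bterms ph)) ->
  modality_free P /\ T (ctx I th (tvars (snd at'))) (imp_dir q P (atom_fml at')).
Proof.
  induction 1 as [F' r t Ht|F' r t h e w P Hin He Hw HP IH]; intros th HF' Hsub.
  - split; [apply atom_fml_modality_free|apply t_imp_dir_refl].
  - cbn [snd] in *.
    set (th' := fun x => tsubst th (sub1 w (tApp h e) x)).
    assert (Ew : th' w = tsubst th (tApp h e)).
    { unfold th', sub1. now rewrite upd_same. }
    assert (Eo : forall x, x <> w -> th' x = th x).
    { intros x n. unfold th', sub1. now rewrite upd_other. }
    assert (Hwe : ~ In w (tvars e)).
    { intro K. apply Hw. apply (subterms_tvars _ _ Hin). exact K. }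
    destruct (IH th') as [MP IHP].
    { intro s. rewrite HF'. now rewrite tsubst_tsubst. }
    { intros s Hs. unfold th'. rewrite <- tsubst_tsubst. apply Hsub.
      now apply subterms_replace. }
    assert (Hbt : In (tApp h (tsubst th e)) (bterms ph)) by apply (Hsub _ Hin).
    destruct (approx_app h _ Hbt) as [HG HV].
    set (G := F (tApp h (tsubst th e))) in *.
    assert (EG : F' (tApp h e) = G) by apply HF'.
    rewrite EG, quant_near_eq.
    assert (MN : modality_free (near_range w G e))
      by now apply fol_R_modality_free, fol_R_near_range.
    split; [destruct q; simpl in *; tauto|].
    set (C := ctx I th (tvars t)).
    (* Common core of both directions: in deriving [S] from [R], one may assume that [w] equals
       [h e], that [w] lies in the perturbation range, and the induction hypothesis. *)
    assert (Hval : forall R S, modality_free R -> ~ In w (fv R) ->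
      modality_free S -> ~ In w (fv S) ->
      (forall D, incl (R :: C) D -> T D (fEq (tApp h e) (tVar w)) ->
         T D (near_range w G e) ->
         match q with
         | QAll => T D P -> T D (atom_fml (r, replace h e w t))
         | QEx => T D (atom_fml (r, replace h e w t)) -> T D P
         end -> T D S) ->
      T (R :: C) S).
    { intros R S MR NR MS NS K.
      apply (t_exE T HT) with w (fEq (tApp h e) (tVar w)).
      - intros Q [<-|[<-|HQ]]; auto. now apply (ctx_fresh I th (tvars t)).
      - apply (t_exI T HT) with (tApp h e); [exact Logic.I|].
        cbn. rewrite sub1_same, tsubst_sub1_fresh by auto.
        apply t_nil, t_eq_refl.
      - set (D := fEq (tApp h e) (tVar w) :: R :: C).
        assert (HE : T D (fEq (tApp h e) (tVar w))) by (apply (t_hyp T HT); simpl; auto).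
        assert (HeI : T D (fin e (I (tsubst th e)))).
        { apply (t_weak T HT) with (ctx I th (tvars e)).
          - apply (t_real T HT).
            + intros Q [<-|HQ]; [simpl; tauto|now apply ctx_fol_R in HQ].
            + intros v Hv. apply sat_fin. apply (enclosure_eval 1 I ph); auto.
              * intros s Hs. apply Hsub. apply subterms_trans with (2 := Hin).
                simpl. auto.
              * now apply sat_ctx.
          - intros Q HQ. unfold D. simpl. do 2 right.
            revert HQ. apply ctx_incl. exact (subterms_tvars _ _ Hin). }
        destruct (t_app_near h e (tsubst th e) w D Hbt He Hwe HeI HE) as [HwI Hnear].
        apply K; auto.
        + unfold D. solve_incl.
        + assert (HC' : T D (imp_dir q P (atom_fml (r, replace h e w t)))).
          { apply t_cut with (1 := HwI). apply (t_weak T HT) with (1 := IHP).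
            intros Q HQ. apply in_map_iff in HQ. destruct HQ as (x & <- & Hx).
            destruct (Nat.eq_dec x w) as [->|n].
            - rewrite Ew. simpl. auto.
            - rewrite Eo by auto. destruct (tvars_replace h e w t x Hx) as [->|Hx'];
                [tauto|]. right. unfold D. simpl. do 2 right.
              apply in_map_iff. exists x. auto. }
          exact (t_imp_dir_hyp q D P _ HC' D (incl_refl _)). }
    assert (Msub : forall D a b, T D (fEq a b) ->
       T D (subst (sub1 w a) (atom_fml (r, replace h e w t))) ->
       T D (subst (sub1 w b) (atom_fml (r, replace h e w t)))).
    { intros D a b. apply t_eq_subst, atom_fml_modality_free. }
    assert (Sapp : subst (sub1 w (tApp h e)) (atom_fml (r, replace h e w t)) =
                   atom_fml (r, t)).
    { rewrite subst_atom_fml. now rewrite tsubst_sub1_replace. }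
    assert (Sself := subst_sub1_self (atom_fml (r, replace h e w t)) w
                       (atom_fml_modality_free _)).
    assert (Nat : ~ In w (fv (atom_fml (r, t)))).
    { intro K. apply Hw. now apply atom_fml_fv in K. }
    assert (Mat := atom_fml_modality_free (r, t)).
    destruct q; cbn [imp_dir]; apply (t_impI T HT); apply Hval; auto;
      try (simpl; tauto); try (simpl; apply remove_In).
    (* The universal quantifier, taken at [w] itself, yields [P] and thus the atom in [w]; the
       equation then turns [w] back into [h e]. *)
    + intros D HD HE Hnear K. rewrite <- Sapp.
      apply Msub with (tVar w); [now apply t_eq_sym|]. rewrite Sself. apply K.
      apply (t_impE T HT) with (2 := Hnear). apply t_allE_self with w; [simpl; auto|].
      apply (t_hyp T HT), HD. simpl. auto.
    (* Conversely [w] is the witness: the equation rewrites the atom into one in [w], which implies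
       [P]. *)
    + intros D HD HE Hnear K. apply t_exI_self; [simpl; auto|].
      apply (t_andI T HT); auto. apply K. rewrite <- Sself.
      apply Msub with (1 := HE). rewrite Sapp. apply (t_hyp T HT), HD. simpl. auto.
Qed.

Lemma t_perturb_clause q c c' :
  Forall2 (perturb_atom q delta F) c c' ->
  (forall at', In at' c -> incl (subterms (snd at')) (bterms ph)) ->
  forall C, (forall at', In at' c -> incl (ctx I tVar (tvars (snd at'))) C) ->
  modality_free (big_or c') /\
  T C (imp_dir q (big_or c') (big_or (map atom_fml c))).
Proof.
  induction 1 as [|at' P c c' HP _ IH]; intros Hsub C HC; simpl.
  - split; [exact Logic.I|apply t_imp_dir_refl].
  - destruct (IH (fun a Ha => Hsub a (or_intror Ha)) C (fun a Ha => HC a (or_intror Ha)))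
      as [M K].
    (* No application has been eliminated yet, so every variable stands for itself. *)
    destruct (t_perturb_atom q F at' P HP tVar) as [MP KP].
    + intro s. now rewrite tsubst_id.
    + intros s Hs. rewrite tsubst_id by auto. apply (Hsub at'); simpl; auto.
    + split; auto. apply t_imp_dir_or; auto.
      apply (t_weak T HT) with (1 := KP). apply HC. simpl. auto.
Qed.

Lemma t_perturb_matrix q psi psi' :
  Forall2 (Forall2 (perturb_atom q delta F)) psi psi' ->
  (forall at', In at' (concat psi) -> incl (subterms (snd at')) (bterms ph)) ->
  forall C, (forall at', In at' (concat psi) -> incl (ctx I tVar (tvars (snd at'))) C) ->
  modality_free (big_and (map big_or psi')) /\
  T C (imp_dir q (big_and (map big_or psi')) (bfml_fml (BMatrix psi))).
Proof.
  induction 1 as [|c c' psi psi' Hc _ IH]; intros Hsub C HC; simpl.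
  - split; [exact Logic.I|apply t_imp_dir_refl].
  - destruct (t_perturb_clause q c c' Hc) with (C := C) as [M1 K1].
    { intros a Ha. apply Hsub. simpl. apply in_app_iff. auto. }
    { intros a Ha. apply HC. simpl. apply in_app_iff. auto. }
    destruct IH with (C := C) as [M2 K2].
    { intros a Ha. apply Hsub. simpl. apply in_app_iff. auto. }
    { intros a Ha. apply HC. simpl. apply in_app_iff. auto. }
    split; auto. now apply t_imp_dir_and.
Qed.

Lemma fv_bfml_matrix psi at' :
  In at' (concat psi) -> incl (tvars (snd at')) (fv (bfml_fml (BMatrix psi))).
Proof.
  intros Hat x Hx. induction psi as [|c psi IH]; simpl in *; [tauto|].
  apply in_app_iff in Hat. apply in_app_iff. destruct Hat as [Hat|Hat]; [left|auto].
  clear IH. induction c as [|a c IH]; simpl in *; [tauto|].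
  apply in_app_iff. destruct Hat as [->|Hat]; [left|auto].
  destruct at' as [[] t]; simpl in *; apply in_app_iff; auto.
Qed.

Lemma bfml_modality_free chi : modality_free (bfml_fml chi).
Proof.
  induction chi as [psi|[] y a b chi IH]; simpl; auto.
  induction psi as [|c psi IH]; simpl; [exact Logic.I|]. split; auto.
  clear IH. induction c as [|a c IH]; simpl; [exact Logic.I|].
  split; auto. apply atom_fml_modality_free.
Qed.

(** The context ranges over the free variables of [chi], so passing a quantifier requires an
    enclosure fact for its bound variable. *)
Lemma t_perturb q chi P : perturb q delta F chi P ->
  incl (bterms chi) (bterms ph) -> incl (bounds chi) (bounds ph) ->
  (forall y a b, In (y, a, b) (bounds chi) ->
     no_fsym a /\ no_fsym b /\ ~ In y (tvars a ++ tvars b)) ->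
  modality_free P /\
  T (ctx I tVar (fv (bfml_fml chi))) (imp_dir q P (bfml_fml chi)).
Proof.
  induction 1 as [psi psi' H|k y a b chi P H IH]; intros Ht Hb Hno.
  - apply t_perturb_matrix; auto.
    + intros at' Hat s Hs. apply Ht. simpl. apply in_flat_map. exists at'. auto.
    + intros at' Hat. apply ctx_incl. now apply fv_bfml_matrix.
  - destruct IH as [MP K].
    + intros s Hs. apply Ht. simpl. rewrite !in_app_iff. auto.
    + intros s Hs. apply Hb. simpl. auto.
    + intros y' a' b' Hin. apply Hno. simpl. auto.
    + destruct (Hno y a b (or_introl eq_refl)) as (Ha & Hb' & Hy).
      assert (Hbd : In (y, a, b) (bounds ph)) by (apply Hb; simpl; auto).
      cbn [bfml_fml].
      assert (Mchi := bfml_modality_free chi).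
      set (l := fv (bquant k y a b (bfml_fml chi))).
      assert (El : l = remove Nat.eq_dec y
        (((tvars a ++ [y]) ++ ([y] ++ tvars b)) ++ fv (bfml_fml chi))).
      { unfold l. destruct k; reflexivity. }
      assert (Hyl : ~ In y l) by (rewrite El; apply remove_In).
      assert (Hal : incl (tvars a) l).
      { intros x Hx. rewrite El. apply in_remove_neq; [rewrite !in_app_iff; auto|].
        intros ->. apply Hy. apply in_app_iff. auto. }
      assert (Hbl : incl (tvars b) l).
      { intros x Hx. rewrite El. apply in_remove_neq; [rewrite !in_app_iff; auto|].
        intros ->. apply Hy. apply in_app_iff. auto. }
      set (N := fAnd (fLe a (tVar y)) (fLe (tVar y) b)).
      (* The endpoints contain no function symbols and their values lie in the interval of [y]; by
         convexity so does everything between them. *)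
      assert (HyI : T (N :: ctx I tVar l) (fin (tVar y) (I (tVar y)))).
      { apply (t_real T HT).
        - intros R [<-|[<-|HR]]; [simpl; tauto|simpl; tauto|now apply ctx_fol_R in HR].
        - intros v Hv. apply sat_fin.
          assert (HN : sat v N) by (apply Hv; simpl; auto).
          assert (Hc : forall x, In x l -> rin (v x) (I (tVar x))).
          { apply sat_ctx with (th := tVar). intros R HR. apply Hv. simpl. auto. }
          assert (EV : forall c, no_fsym c -> incl (subterms c) (bterms ph) ->
                    incl (tvars c) l -> rin (eval v c) (I c)).
          { intros c Hc1 Hc2 Hc3.
            rewrite <- (tsubst_id c tVar) at 2 by auto.
            apply (enclosure_eval 1 I ph); auto.
            intros s Hs. rewrite tsubst_id by auto. auto. }
          assert (Ra : rin (eval v a) (I a)).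
          { apply EV; auto. intros s Hs. apply Ht. simpl. rewrite !in_app_iff. auto. }
          assert (Rb : rin (eval v b) (I b)).
          { apply EV; auto. intros s Hs. apply Ht. simpl. rewrite !in_app_iff. auto. }
          destruct HI as (_ & HIb & _).
          assert (R1 := HIb _ _ _ _ Hbd (or_introl Ra)).
          assert (R2 := HIb _ _ _ _ Hbd (or_intror Rb)).
          unfold rin in *. simpl in HN |- *. lra. }
      assert (K' : T (N :: ctx I tVar l) (imp_dir q P (bfml_fml chi))).
      { apply t_cut with (1 := HyI). apply (t_weak T HT) with (1 := K).
        intros R HR. apply in_map_iff in HR. destruct HR as (x & <- & Hx).
        destruct (Nat.eq_dec x y) as [->|n]; [simpl; auto|].
        simpl. do 2 right. apply in_map_iff. exists x. split; auto.
        rewrite El. apply in_remove_neq; auto. rewrite !in_app_iff. auto. }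
      split; [destruct k; simpl; tauto|].
      destruct q; apply t_bquant_mono; auto; now apply ctx_fresh.
Qed.

Lemma t_delta_rule q xs A :
  Fml_B ph -> NoDup xs -> (forall x, In x xs <-> In x (fv (bfml_fml ph))) ->
  perturb q delta F ph A -> T [] (foralls_in I xs (imp_dir q A (bfml_fml ph))).
Proof.
  intros [HB _] Hnd Hxs HA.
  destruct (t_perturb q ph A HA (incl_refl _) (incl_refl _) HB) as [_ K].
  apply (t_foralls_in I xs []); rewrite app_nil_r; auto.
  apply (t_weak T HT) with (1 := K). apply ctx_incl. intros x Hx. now apply Hxs.
Qed.

End Perturbation.
End Entailment.

(** * Soundness and derivability of the two rules *)

(** Supplies the enclosure condition on applications in the semantic instance. *)
Lemma enclosure_valid I ph h e :
  enclosure 1 I ph -> In (tApp h e) (bterms ph) ->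
  valid (forall_in 0%nat (I e)
         (bquant QAll 1%nat (tConst (- (1))) (tConst 1)
           (fin (tAdd (tApp h (tVar 0%nat)) (tVar 1%nat)) (I (tApp h e))))).
Proof.
  intros (_ & _ & _ & _ & H) Hin w u Hu r Hr.
  apply sat_fin. apply H; auto.
  cbn [sat fLe cmp_sem eval] in Hr. rewrite upd_same, Q2R_opp in Hr.
  cbn [eval]. now rewrite upd_same.
Qed.

Theorem theorem4p14 (ph : bfml) (xs : list var) (F : approx) (delta : Q)
    (I : term -> QIntv) (Aall Aex : fml) :
  Fml_B ph ->
  NoDup xs -> (forall x, In x xs <-> In x (fv (bfml_fml ph))) ->
  approximation F ph ->
  (0 < delta)%Q -> (delta < 1 # 2)%Q ->
  enclosure 1 I ph ->
  perturb QAll delta F ph Aall ->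
  perturb QEx delta F ph Aex ->
  let prem := delta_premise F delta I ph in
  let concl_all := foralls_in I xs (fImp Aall (bfml_fml ph)) in
  let concl_ex := foralls_in I xs (fImp (bfml_fml ph) Aex) in
  (sound_rule prem concl_all /\ sound_rule prem concl_ex) /\
  (provable_enclosure 1 I ph ->
     derivable_rule prem concl_all /\ derivable_rule prem concl_ex).
Proof.
  intros HB Hnd Hxs HF _ _ HI Hall Hex prem concl_all concl_ex.
  assert (Hs : forall q A, perturb q delta F ph A ->
    sound_rule prem (foralls_in I xs (imp_dir q A (bfml_fml ph)))).
  { intros q A HA Hp w.
    refine (t_delta_rule _ consequence_entailment ph F delta I HF HI _ _ q xs A
              HB Hnd Hxs HA w _).
    - intros v _. apply Hp.
    - intros h e Hin v _. now apply (enclosure_valid I ph).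
    - intros R []. }
  assert (Hd : provable_enclosure 1 I ph -> forall q A, perturb q delta F ph A ->
    derivable_rule prem (foralls_in I xs (imp_dir q A (bfml_fml ph)))).
  { intros (_ & _ & _ & _ & He) q A HA.
    refine (t_delta_rule _ (prov_entailment _) ph F delta I HF HI _ _ q xs A
              HB Hnd Hxs HA).
    (* The premise is a hypothesis of the derivation, whereas the enclosure condition is provable
       outright. *)
    - apply pr_hyp. simpl. auto.
    - intros h e Hin. apply prov_mono with (1 := He h e Hin). apply incl_nil. }
  split; [split|intro He; split].
  - exact (Hs QAll Aall Hall).
  - exact (Hs QEx Aex Hex).
  - exact (Hd He QAll Aall Hall).
  - exact (Hd He QEx Aex Hex).
Qed.
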